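(* Let $\mathcal H$ be a separable right quaternionic Hilbert space with $\dim_{\mathbb H}\mathcal H=\infty$, let $T=T^*\in\mathcal B(\mathcal H)$ with spectral measure $E$, and let $\lambda\in\sigma_S(T)$. The following are equivalent: (i) $\lambda\notin\sigma_e^S(T)$; (ii) $\lambda\in\sigma_d^S(T)$; (iii) $\lambda$ is isolated in $\sigma_S(T)$ and $\dim_{\mathbb H}\ker(T-\lambda\,\mathrm{Id})<\infty$; (iv) $\lambda$ is isolated in $\sigma_S(T)$ and $E(\{\lambda\})$ has finite rank.
   Context: A right quaternionic Hilbert space $\mathcal H$ is a right $\mathbb H$-module with an $\mathbb H$-valued inner product that is right linear in the second argument, hermitian, positive definite, and complete for $\|x\|=\langle x,x\rangle^{1/2}$. $\mathcal B(\mathcal H)$ is the real unital Banach algebra of bounded right linear operators on $\mathcal H$, $T^*$ is the adjoint, $\mathrm{Id}$ the identity. $\dim_{\mathbb H}W$ is the cardinality of an orthonormal basis of a closed right submodule $W$. For $q\in\mathbb H$ put $Q_q(T)=T^2-2\operatorname{Re}(q)T+|q|^2\mathrm{Id}$. The $S$-spectrum is $\sigma_S(T)=\{q\in\mathbb H: Q_q(T)\text{ is not invertible in }\mathcal B(\mathcal H)\}$; the same definition is used for restrictions of $T$ to closed invariant right submodules (on $\{0\}$ it is empty). For self-adjoint $T$ one has $\sigma_S(T)\subset\mathbb R$. The sphere of $q$ is $[q]=\{\operatorname{Re}(q)+I|\operatorname{Im}(q)|: I\in\mathbb H,\ I^2=-1\}$ (so $[\lambda]=\{\lambda\}$ for real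 $\lambda$). An operator $A\in\mathcal B(\mathcal H)$ is Fredholm, $A\in\Phi(\mathcal H)$, if $\operatorname{ran}(A)$ is closed, $\dim_{\mathbb H}\ker(A)<\infty$ and $\dim_{\mathbb H}\ker(A^* )<\infty$. Set $\sigma_e^S(T)=\{q\in\mathbb H: Q_q(T)\notin\Phi(\mathcal H)\}$. The discrete $S$-spectrum $\sigma_d^S(T)$ is the set of right eigenvalues of finite type: those $q\in\sigma_S(T)$ for which $\mathcal H=\mathcal H_1\oplus\mathcal H_2$ is a topological direct sum of closed $T$-invariant right submodules with $\dim_{\mathbb H}\mathcal H_1<\infty$, $\sigma_S(T|_{\mathcal H_1})\cap\sigma_S(T|_{\mathcal H_2})=\varnothing$ and $\sigma_S(T|_{\mathcal H_1})=[q]$. The spectral measure of $T=T^*$ is the unique projection-valued measure $E$ on the Borel sets of $\mathbb R$ (values orthogonal projections in $\mathcal B(\mathcal H)$, $E(\mathbb R)=\mathrm{Id}$, $E(B_1\cap B_2)=E(B_1)E(B_2)$, strongly countably additive) with $T=\int_{\mathbb R}t\,dE(t)$; it has support $\sigma_S(T)$ (existence and uniqueness are the known quaternionic spectral theorem). *)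

(* Defs.v *)
From HB Require Import structures.
From mathcomp Require Import all_boot all_order all_algebra ring.
From mathcomp Require Import all_classical all_reals all_analysis.

Set Implicit Arguments.
Unset Strict Implicit.
Unset Printing Implicit Defensive.

Import Order.TTheory GRing.Theory Num.Theory.
Import numFieldNormedType.Exports.

Local Open Scope classical_set_scope.
Local Open Scope ring_scope.

(* [Quat a b c d] is a + b i + c j + d k. *)
Record quat (R : realType) := Quat { qre : R; qi : R; qj : R; qk : R }.

Definition quat_coords (R : realType) (q : quat R) : R * R * R * R :=
  (qre q, qi q, qj q, qk q).
Definition quat_of_coords (R : realType) (p : R * R * R * R) : quat R :=
  let: (a, b, c, d) := p in Quat a b c d.
Lemma quat_coordsK (R : realType) :
  cancel (@quat_coords R) (@quat_of_coords R).
Proof. by case. Qed.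

HB.instance Definition _ (R : realType) :=
  Choice.copy (quat R) (can_type (@quat_coordsK R)).

(* The topology of R^4, that is the one given by qnorm. *)
HB.instance Definition _ (R : realType) :=
  Topological.copy (quat R) (initial_topology (@quat_coords R)).

Section QuatRing.
Variable R : realType.
Implicit Types p q : quat R.

Definition quat_add p q :=
  Quat (qre p + qre q) (qi p + qi q) (qj p + qj q) (qk p + qk q).
Definition quat_opp q := Quat (- qre q) (- qi q) (- qj q) (- qk q).
Definition quat_mul p q :=
  Quat (qre p * qre q - qi p * qi q - qj p * qj q - qk p * qk q)
       (qre p * qi q + qi p * qre q + qj p * qk q - qk p * qj q)
       (qre p * qj q - qi p * qk q + qj p * qre q + qk p * qi q)
       (qre p * qk q + qi p * qj q - qj p * qi q + qk p * qre q).

Fact quat_addA : associative quat_add.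
Proof. by move=> [????] [????] [????]; congr Quat; apply: addrA. Qed.
Fact quat_addC : commutative quat_add.
Proof. by move=> [????] [????]; congr Quat; apply: addrC. Qed.
Fact quat_add0 : left_id (Quat 0 0 0 0) quat_add.
Proof. by move=> [????]; congr Quat; apply: add0r. Qed.
Fact quat_addN : left_inverse (Quat 0 0 0 0) quat_opp quat_add.
Proof. by move=> [????]; congr Quat; apply: addNr. Qed.
HB.instance Definition _ :=
  GRing.isZmodule.Build (quat R) quat_addA quat_addC quat_add0 quat_addN.

Fact quat_mulA : associative quat_mul.
Proof. by move=> [????] [????] [????]; congr Quat => /=; ring. Qed.
Fact quat_mul1q : left_id (Quat 1 0 0 0) quat_mul.
Proof. by move=> [????]; congr Quat => /=; ring. Qed.
Fact quat_mulq1 : right_id (Quat 1 0 0 0) quat_mul.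
Proof. by move=> [????]; congr Quat => /=; ring. Qed.
Fact quat_mulDl : left_distributive quat_mul +%R.
Proof. by move=> [????] [????] [????]; congr Quat => /=; ring. Qed.
Fact quat_mulDr : right_distributive quat_mul +%R.
Proof. by move=> [????] [????] [????]; congr Quat => /=; ring. Qed.
Fact quat_one_neq0 : Quat 1 0 0 0 != 0 :> quat R.
Proof. by apply/eqP => -[] /eqP; rewrite oner_eq0. Qed.
HB.instance Definition _ := GRing.Zmodule_isNzRing.Build (quat R)
  quat_mulA quat_mul1q quat_mulq1 quat_mulDl quat_mulDr quat_one_neq0.

Definition qreal (r : R) : quat R := Quat r 0 0 0.
Definition qconj q : quat R := Quat (qre q) (- qi q) (- qj q) (- qk q).
Definition qim q : quat R := q - qreal (qre q).
Definition qnorm q : R :=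
  Num.sqrt (qre q ^+ 2 + qi q ^+ 2 + qj q ^+ 2 + qk q ^+ 2).

Definition qsphere q : set (quat R) :=
  [set p | exists I : quat R,
     I * I = -1 /\ p = qreal (qre q) + I * qreal (qnorm (qim q))].

End QuatRing.

Notation "r %:q" := (qreal r) (at level 1, left associativity, format "r %:q")
  : ring_scope.

(* [qscale x a] is x a.  The underlying complete normed real space is the one
   obtained by restricting scalars to R: [qscale_real] and [qinner_norm] force
   its scaling and its norm to be those determined by [qscale] and [qinner].
   Positive definiteness of [qinner] is contained in [qinner_norm]. *)
HB.mixin Record CompleteNormedModule_isQuatHilbert (R : realType) H
    of CompleteNormedModule R H := {
  qscale : H -> quat R -> H;
  qinner : H -> H -> quat R;
  qscaleDl : forall (x : H) (a b : quat R),
    qscale x (a + b) = qscale x a + qscale x b;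
  qscaleDr : forall (x y : H) (a : quat R),
    qscale (x + y) a = qscale x a + qscale y a;
  qscaleA : forall (x : H) (a b : quat R),
    qscale (qscale x a) b = qscale x (a * b);
  qscale_real : forall (x : H) (r : R), qscale x r%:q = r *: x;
  qinnerDr : forall x y z : H, qinner x (y + z) = qinner x y + qinner x z;
  qinnerZr : forall (x y : H) (a : quat R),
    qinner x (qscale y a) = qinner x y * a;
  qinner_conj : forall x y : H, qinner x y = qconj (qinner y x);
  qinner_norm : forall x : H, qinner x x = (`|x| ^+ 2)%:q
}.

#[short(type="quatHilbertType")]
HB.structure Definition QuatHilbert (R : realType) :=
  { H of CompleteNormedModule_isQuatHilbert R H & CompleteNormedModule R H }.

Section QuatHilbertTheory.
Variables (R : realType) (H : quatHilbertType R).
Implicit Types (W : set H) (A T P : H -> H) (q : quat R).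

Definition separable_space := exists D : set H, countable D /\ dense D.

Definition qsubmodule W :=
  [/\ W 0, forall x y, W x -> W y -> W (x + y) &
      forall x (a : quat R), W x -> W (qscale x a)].

Definition closed_qsubmodule W := qsubmodule W /\ closed W.

Definition orthonormal (B : set H) :=
  forall x y, B x -> B y -> qinner x y = (x == y)%:R :> quat R.

Definition orthonormal_basis W (B : set H) :=
  [/\ B `<=` W, orthonormal B & closure (smallest qsubmodule B) = W].

Definition finite_qdim W :=
  exists B, orthonormal_basis W B /\ finite_set B.

(* Elements of B(W), for a closed right submodule W, are represented by maps
   H -> H of which only the values on W matter. *)
Definition bounded_op_on W A :=
  [/\ forall x, W x -> W (A x),
      forall x y, W x -> W y -> A (x + y) = A x + A y,
      forall x (a : quat R), W x -> A (qscale x a) = qscale (A x) a &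
      exists M : R, forall x, W x -> `|A x| <= M * `|x|].

Definition invertible_on W A :=
  exists S, bounded_op_on W S /\ forall x, W x -> S (A x) = x /\ A (S x) = x.

Definition bounded_op A := bounded_op_on setT A.

Definition op_ker A : set H := [set x | A x = 0].

(* For bounded A the adjoint exists and is unique; 0 is a default value. *)
Definition adjoint A : H -> H :=
  xget (fun=> 0)
    [set S | bounded_op S /\ forall x y, qinner (S x) y = qinner x (A y)].

Definition Qop q T : H -> H :=
  fun x => T (T x) - (2 * qre q) *: T x + (qnorm q ^+ 2) *: x.

(* The S-spectrum of the restriction of T to the T-invariant W. *)
Definition S_spectrum_on W T : set (quat R) :=
  [set q | ~ invertible_on W (Qop q T)].

Definition S_spectrum T : set (quat R) := S_spectrum_on setT T.

Definition Fredholm A :=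
  [/\ bounded_op A, closed (range A), finite_qdim (op_ker A) &
      finite_qdim (op_ker (adjoint A))].

Definition essential_S_spectrum T : set (quat R) :=
  [set q | ~ Fredholm (Qop q T)].

(* The bound states that the projections of the direct sum are continuous. *)
Definition topological_direct_sum W1 W2 :=
  [/\ W1 `&` W2 = [set 0],
      forall x, exists x1 x2, [/\ W1 x1, W2 x2 & x = x1 + x2] &
      exists M : R, forall x1 x2, W1 x1 -> W2 x2 ->
        `|x1| <= M * `|x1 + x2| /\ `|x2| <= M * `|x1 + x2|].

Definition invariant T W := forall x, W x -> W (T x).

Definition discrete_S_spectrum T : set (quat R) :=
  [set q | S_spectrum T q /\
     exists H1 H2 : set H,
       [/\ closed_qsubmodule H1 /\ closed_qsubmodule H2,
           invariant T H1 /\ invariant T H2,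
           topological_direct_sum H1 H2,
           finite_qdim H1 &
           S_spectrum_on H1 T `&` S_spectrum_on H2 T = set0 /\
           S_spectrum_on H1 T = qsphere q]].

Definition orthogonal_projection P :=
  [/\ bounded_op P, P \o P = P & adjoint P = P].

(* Only the values of E on Borel sets are meaningful. *)
Definition projection_valued_measure (E : set R -> H -> H) :=
  [/\ forall B : set R, measurable B -> orthogonal_projection (E B),
      E setT = id,
      forall B1 B2 : set R, measurable B1 -> measurable B2 ->
        E (B1 `&` B2) = E B1 \o E B2 &
      forall F : (set R)^nat, (forall n, measurable (F n)) ->
        trivIset setT F ->
        forall x, series (fun n => E (F n) x) @ \oo --> E (\bigcup_n F n) x].

(* T is the integral of t with respect to E, in the weak sense:
   <x, T x> is the integral of t with respect to the positive measure
   B |-> <x, E(B) x>, for every x in H.  By polarization this determines T. *)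
Definition spectral_integral_id (E : set R -> H -> H) T :=
  forall x, exists mu : {measure set R -> \bar R},
    [/\ forall B : set R, measurable B -> qinner x (E B x) = (fine (mu B))%:q /\
                                  (mu B < +oo)%E,
        mu.-integrable setT (fun t : R => t%:E) &
        qinner x (T x) = (\int[mu]_t t)%:q].

Definition spectral_measure T (E : set R -> H -> H) :=
  projection_valued_measure E /\ spectral_integral_id E T.

End QuatHilbertTheory.

Arguments separable_space {R} H.

(* Main.v *)
(* Put A = T - lambda, so that Q_lambda(T) = A^2.  Splitting the form <x, T x>
   along E(B) + E(B^c) shows that E commutes with T, and integrating bounds on t
   gives |A x| >= d |x| on ran E(|t - lambda| >= d), |A x| <= d |x| on
   ran E(|t - lambda| <= d) and ker A = ker A^2 = ran E({lambda}).  A bounded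
   operator whose form is coercive on a closed submodule is invertible there, so
   the S-spectrum of T on any closed invariant submodule is real and is
   controlled by lower bounds for T - a.
   (i) => (ii): when ran A^2 is closed it contains ran E({lambda}^c), which is
   the closure of the union of the ran E(|t - lambda| >= 1/n), hence A^2 is
   bijective there, with bounded inverse by Banach-Steinhaus; decompose H by
   E({lambda}).
   (ii) => (iii): Q_a(T) is invertible on H_2 for a near lambda, and on H_1 for
   a <> lambda, while ker A lies in H_1.
   (iii) => (iv): ker A = ran E({lambda}).
   (iv) => (i): E vanishes on a punctured neighbourhood of lambda, so ran A^2 is
   ran E(|t - lambda| >= d) for some d > 0. *)
From HB Require Import structures.
Require Import Defs.
From mathcomp Require Import all_boot all_order all_algebra ring lra.
From mathcomp Require Import all_classical all_reals all_analysis.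
Set Implicit Arguments.
Unset Strict Implicit.
Unset Printing Implicit Defensive.
(* Some names of Defs, e.g. invariant and orthonormal, are shadowed above. *)
Import Defs.
Import Order.TTheory GRing.Theory Num.Theory.
Import numFieldNormedType.Exports.
Local Open Scope classical_set_scope.
Local Open Scope ring_scope.

(** * The underlying real inner product space *)

Section RealInner.
Variables (R : realType) (H : quatHilbertType R).
Implicit Types (x y z : H) (W : set H) (a : R).

Lemma qreD (p q : quat R) : qre (p + q) = qre p + qre q.
Proof. by []. Qed.

(** A real inner product inducing the same norm; all norm and coercivity estimates only need this
    real part. *)
Definition rip x y : R := qre (qinner x y).

Lemma ripC x y : rip x y = rip y x.
Proof. by rewrite /rip qinner_conj. Qed.

Lemma ripDr x y z : rip x (y + z) = rip x y + rip x z.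
Proof. by rewrite /rip qinnerDr qreD. Qed.

Lemma ripZr x y a : rip x (a *: y) = a * rip x y.
Proof.
by rewrite /rip -qscale_real qinnerZr /= !mulr0 !subr0 mulrC.
Qed.

Lemma ripDl x y z : rip (x + y) z = rip x z + rip y z.
Proof. by rewrite ripC ripDr !(ripC z). Qed.

Lemma ripZl x y a : rip (a *: x) y = a * rip x y.
Proof. by rewrite ripC ripZr ripC. Qed.

Lemma ripNr x y : rip x (- y) = - rip x y.
Proof. by rewrite -scaleN1r ripZr mulN1r. Qed.

Lemma ripNl x y : rip (- x) y = - rip x y.
Proof. by rewrite ripC ripNr ripC. Qed.

Lemma ripBr x y z : rip x (y - z) = rip x y - rip x z.
Proof. by rewrite ripDr ripNr. Qed.

Lemma ripBl x y z : rip (x - y) z = rip x z - rip y z.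
Proof. by rewrite ripDl ripNl. Qed.

Lemma ripxx x : rip x x = `|x| ^+ 2.
Proof. by rewrite /rip qinner_norm. Qed.

Lemma rip_cauchy_schwarz x y : rip x y <= `|x| * `|y|.
Proof.
have [->|x0] := eqVneq x 0.
  have -> : (0 : H) = 0 *: 0 by rewrite scale0r.
  by rewrite ripZl mul0r scale0r normr0 mul0r.
have [->|y0] := eqVneq y 0.
  have -> : (0 : H) = 0 *: 0 by rewrite scale0r.
  by rewrite ripZr mul0r scale0r normr0 mulr0.
have px : 0 < `|x| by rewrite normr_gt0.
have py : 0 < `|y| by rewrite normr_gt0.
(* With these weights the expanded square is a positive multiple of [|x| |y| - rip x y]. *)
have : 0 <= rip (`|y| *: x - `|x| *: y) (`|y| *: x - `|x| *: y).
  by rewrite ripxx sqr_ge0.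
rewrite !(ripBl, ripBr, ripZl, ripZr) !ripxx (ripC y x) => h.
have : 0 <= (2 * `|x| * `|y|) * (`|x| * `|y| - rip x y) by nra.
by rewrite pmulr_rge0 ?subr_ge0// !mulr_gt0.
Qed.

Lemma sqr_normB x y : `|x - y| ^+ 2 = `|x| ^+ 2 - 2 * rip x y + `|y| ^+ 2.
Proof. by rewrite -!ripxx !(ripBl, ripBr) (ripC y x); ring. Qed.

Lemma sqr_normD x y : `|x + y| ^+ 2 = `|x| ^+ 2 + 2 * rip x y + `|y| ^+ 2.
Proof. by rewrite -!ripxx !(ripDl, ripDr) (ripC y x); ring. Qed.

Lemma sqr_norm_eq0 x : (`|x| ^+ 2 == 0) = (x == 0).
Proof. by rewrite sqrf_eq0 normr_eq0. Qed.

Lemma ler_norm_sqrr (V W : normedModType R) (v : V) (w : W) (c : R) : 0 <= c ->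
  (`|v| <= c * `|w|) = (`|v| ^+ 2 <= c ^+ 2 * `|w| ^+ 2).
Proof. by move=> c0; rewrite -exprMn ler_sqr ?nnegrE ?mulr_ge0. Qed.

Lemma ler_norm_sqrl (V W : normedModType R) (v : V) (w : W) (c : R) : 0 <= c ->
  (c * `|w| <= `|v|) = (c ^+ 2 * `|w| ^+ 2 <= `|v| ^+ 2).
Proof. by move=> c0; rewrite -exprMn ler_sqr ?nnegrE ?mulr_ge0. Qed.

End RealInner.

(** * Bounded operators on closed submodules and criteria for invertibility *)

Section BoundedOperators.
Variables (R : realType) (H : quatHilbertType R).
Implicit Types (x y z : H) (W : set H) (a : R) (A T : H -> H).

Lemma qsubmoduleZ W x a : qsubmodule W -> W x -> W (a *: x).
Proof. by case=> _ _ WZ Wx; rewrite -qscale_real; exact: WZ. Qed.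

Lemma qsubmoduleB W x y : qsubmodule W -> W x -> W y -> W (x - y).
Proof.
move=> Wm Wx Wy; have [_ WD _] := Wm.
by apply: WD => //; rewrite -scaleN1r; exact: qsubmoduleZ.
Qed.

Lemma qsubmoduleT : qsubmodule [set: H]. Proof. by []. Qed.

Lemma qscaleZl x a (q : quat R) : qscale (a *: x) q = a *: qscale x q.
Proof.
rewrite -!qscale_real !qscaleA; congr qscale.
by case: q => *; congr Quat => /=; ring.
Qed.

Section OnSubmodule.
Variables (W : set H) (A : H -> H).

Lemma bounded_op_onZ x a :
  bounded_op_on W A -> W x -> A (a *: x) = a *: A x.
Proof. by case=> _ _ AZ _ Wx; rewrite -!qscale_real AZ. Qed.

Lemma bounded_op_onB x y : qsubmodule W -> bounded_op_on W A -> W x -> W y ->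
  A (x - y) = A x - A y.
Proof.
move=> Wm bA Wx Wy; have [_ AD _ _] := bA.
rewrite -[- y]scaleN1r AD ?(bounded_op_onZ _ bA) ?scaleN1r//.
by rewrite -scaleN1r; exact: qsubmoduleZ.
Qed.

Lemma bounded_op_onP : bounded_op_on W A ->
  exists2 M, 0 < M & forall x, W x -> `|A x| <= M * `|x|.
Proof.
case=> _ _ _ [M AM]; exists (`|M| + 1); first by rewrite ltr_wpDl.
move=> x Wx; rewrite (le_trans (AM _ Wx))// ler_wpM2r//.
by rewrite (le_trans (ler_norm M))// lerDl.
Qed.

End OnSubmodule.

Section Global.
Variable A : H -> H.
Hypothesis bA : bounded_op A.

Lemma bounded_opD x y : A (x + y) = A x + A y.
Proof. by case: bA => _ AD _ _; rewrite AD. Qed.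

Lemma bounded_opZ x a : A (a *: x) = a *: A x.
Proof. exact: (bounded_op_onZ _ bA). Qed.

Lemma bounded_op_scale x (q : quat R) : A (qscale x q) = qscale (A x) q.
Proof. by case: bA => _ _ AZ _; rewrite AZ. Qed.

Lemma bounded_opB x y : A (x - y) = A x - A y.
Proof. exact: (bounded_op_onB qsubmoduleT bA). Qed.

Lemma bounded_op0 : A 0 = 0.
Proof. by rewrite -(scale0r (0 : H)) bounded_opZ !scale0r. Qed.

Lemma bounded_opW W : invariant A W -> bounded_op_on W A.
Proof.
case: bA => _ AD AZ [M AM] AW; split=> // *; [exact: AD|exact: AZ|].
by exists M => *; exact: AM.
Qed.

Lemma bounded_op_continuous : continuous A.
Proof.
have [M M0 AM] := bounded_op_onP bA.
move=> x; apply/cvgrPdist_lt => e e0; near=> y.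
rewrite -bounded_opB (le_lt_trans (AM _ I))// mulrC -ltr_pdivlMr//.
by near: y; apply: cvgr_dist_lt => //; rewrite divr_gt0.
Unshelve. all: by end_near. Qed.

Lemma closed_ker : closed_qsubmodule (op_ker A).
Proof.
split.
  split => [|x y|x q]; rewrite /op_ker /= ?bounded_op0//.
    by rewrite bounded_opD => -> ->; rewrite addr0.
  rewrite bounded_op_scale => ->.
  by rewrite -(scale0r (0 : H)) qscaleZl !scale0r.
rewrite (_ : op_ker A = A @^-1` [set 0])//.
apply: preimage_closed; last first.
  exact/accessible_closed_set1/hausdorff_accessible/norm_hausdorff.
by move=> *; exact: bounded_op_continuous.
Qed.

End Global.

Lemma bounded_op_id : bounded_op (id : H -> H).
Proof. by split => //; exists 1 => *; rewrite mul1r. Qed.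

Lemma bounded_op_lincomb A B a b : bounded_op A -> bounded_op B ->
  bounded_op (fun x => a *: A x + b *: B x).
Proof.
move=> bA bB; split => // [x y _ _|x q _|].
- by rewrite (bounded_opD bA) (bounded_opD bB) !scalerDr addrACA.
- by rewrite (bounded_op_scale bA) (bounded_op_scale bB) qscaleDr !qscaleZl.
have [M _ AM] := bounded_op_onP bA; have [N _ BN] := bounded_op_onP bB.
exists (`|a| * M + `|b| * N) => x _.
rewrite (le_trans (ler_normD _ _))// mulrDl -!mulrA !normrZ.
by rewrite lerD// ler_wpM2l// ?(AM _ I) ?(BN _ I).
Qed.

Lemma bounded_op_comp A B : bounded_op A -> bounded_op B ->
  bounded_op (A \o B).
Proof.
move=> bA bB; split => // [x y _ _|x q _|] /=.
- by rewrite (bounded_opD bB) (bounded_opD bA).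
- by rewrite (bounded_op_scale bB) (bounded_op_scale bA).
have [M M0 AM] := bounded_op_onP bA; have [N _ BN] := bounded_op_onP bB.
exists (M * N) => x _; rewrite (le_trans (AM _ I))// -mulrA ler_wpM2l//.
  exact: ltW.
exact: BN.
Qed.

(** The lower bound gives injectivity, which makes the pointwise chosen inverse linear, and bounds
    that inverse by [c^-1]. *)
Lemma invertible_onI W A c : closed_qsubmodule W -> bounded_op_on W A ->
  0 < c -> (forall x, W x -> c * `|x| <= `|A x|) ->
  (forall y, W y -> exists2 x, W x & A x = y) -> invertible_on W A.
Proof.
move=> [Wm _] bA c0 Ac Asurj; have [W0 WD WZ] := Wm; have [AW AD AZ _] := bA.
have Ainj x y : W x -> W y -> A x = A y -> x = y.
  move=> Wx Wy Axy; apply/eqP; rewrite -subr_eq0 -normr_le0.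
  have := Ac _ (qsubmoduleB Wm Wx Wy).
  by rewrite (bounded_op_onB Wm bA)// Axy subrr normr0 pmulr_rle0.
(* Outside [W] the value of the inverse is irrelevant; 0 is taken. *)
have /choice[S SP] : forall y, exists x, W y -> W x /\ A x = y.
  move=> y; have [Wy|] := pselect (W y); last by exists 0.
  by have [x] := Asurj _ Wy; exists x.
have WS y : W y -> W (S y) by case/SP.
have AS y : W y -> A (S y) = y by case/SP.
exists S; split; last first.
  by move=> x Wx; split; rewrite ?AS//; apply: Ainj; rewrite ?AS//; auto.
split=> //.
- move=> x y Wx Wy; apply: Ainj; rewrite ?AD ?AS//; auto.
- move=> x a Wx; apply: Ainj; rewrite ?AZ ?AS//; auto.
- exists c^-1 => x Wx; rewrite ler_pdivlMl//.
  by rewrite (le_trans (Ac _ _)) ?AS//; auto.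
Qed.

(** Coercivity gives the lower bound by Cauchy-Schwarz. A solution of [A x = y] is a fixed point of
    [x + t (y - A x)], a contraction of the complete set [W] for a suitable [t]. *)
Lemma lax_milgram W A c : closed_qsubmodule W -> bounded_op_on W A ->
  0 < c -> (forall x, W x -> c * `|x| ^+ 2 <= rip x (A x)) ->
  invertible_on W A.
Proof.
move=> [Wm Wcl] bA c0 Ac; have [W0 WD WZ] := Wm; have [AW AD AZ _] := bA.
have [M M0 AM] := bounded_op_onP bA.
have Acn x : W x -> c * `|x| <= `|A x|.
  move=> Wx; have [->|x0] := eqVneq x 0; first by rewrite normr0 mulr0.
  rewrite -(ler_pM2l (_ : 0 < `|x|)) ?normr_gt0// mulrCA -expr2.
  by rewrite (le_trans (Ac _ Wx))// rip_cauchy_schwarz.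
apply: (invertible_onI _ bA c0 Acn) => // y Wy.
(* For a difference [u], [|u - t A u|^2 <= (1 - 2 c t + t^2 M^2) |u|^2]. This [t] satisfies
   [t M^2 <= c], leaving the factor [1 - c t], and the term [c^2] ensures [c t <= 1]. *)
pose t := c / (M ^+ 2 + c ^+ 2); pose f x := x + t *: (y - A x).
have D0 : 0 < M ^+ 2 + c ^+ 2 by rewrite addr_gt0// exprn_gt0.
have t0 : 0 < t by rewrite divr_gt0.
pose k := 1 - c * t.
have ct1 : c * t <= 1.
  by rewrite /t mulrA ler_pdivrMr// mul1r -expr2 lerDr ltW// exprn_gt0.
have k0 : 0 <= k by rewrite subr_ge0.
have k1 : Num.sqrt k < 1.
  rewrite -(sqrtr1 R) ltr_sqrt//.
  by rewrite /k ltrBlDl ltrDr mulr_gt0.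
have fW : set_fun W W f.
  by move=> x Wx; apply: WD => //; apply: qsubmoduleZ => //;
    apply: qsubmoduleB => //; exact: AW.
pose F : {fun W >-> W} := HB.pack f (isFun.Build _ _ _ _ f fW).
have FK : @is_contraction _ H H W W F.
  exists (NngNum (sqrtr_ge0 k)); split => //= -[x z] [/= Wx Wz].
  have Wxz : W (x - z) by exact: qsubmoduleB.
  have -> : f x - f z = (x - z) - t *: A (x - z).
    rewrite (bounded_op_onB Wm bA)// /f opprD addrACA -scalerBr.
    by rewrite !opprB [_ + (_ - y)]addrC addrA subrK -scalerN opprB.
  rewrite ler_norm_sqrr// sqr_sqrtr// sqr_normB ripZr normrZ exprMn.
  rewrite (gtr0_norm t0).
  have := AM _ Wxz; rewrite (ler_norm_sqrr _ _ (ltW M0)) => h1.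
  have h2 := Ac _ Wxz.
  have h3 : t ^+ 2 * `|A (x - z)| ^+ 2 <= t ^+ 2 * (M ^+ 2 * `|x - z| ^+ 2).
    by rewrite ler_wpM2l// sqr_ge0.
  have h4 : t * (c * `|x - z| ^+ 2) <= t * rip (x - z) (A (x - z)).
    by rewrite ler_wpM2l// ltW.
  have h5 : t ^+ 2 * M ^+ 2 <= c * t.
    rewrite [leRHS]mulrC expr2 -mulrA ler_wpM2l ?(ltW t0)//.
    rewrite /t mulrAC ler_pdivrMr// ler_wpM2l ?(ltW c0)//.
    by rewrite lerDl sqr_ge0.
  have h6 : t ^+ 2 * M ^+ 2 * `|x - z| ^+ 2 <= c * t * `|x - z| ^+ 2.
    by rewrite ler_wpM2r// sqr_ge0.
  rewrite /k; lra.
have W_ne : W !=set0 by exists 0.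
have [x Wx /= xE] := banach_fixed_point FK Wcl W_ne.
exists x => //; move/eqP: xE.
rewrite -subr_eq0 /f opprD addrA subrr add0r oppr_eq0 scaler_eq0 gt_eqF//=.
by rewrite subr_eq0 => /eqP.
Qed.

End BoundedOperators.

(** * The operators [Qop q T] for symmetric [T], and their invertibility *)

Section Qop.
Variables (R : realType) (H : quatHilbertType R).
Implicit Types (x y z : H) (W : set H) (a : R) (A T : H -> H) (q : quat R).

Definition qsymmetric T := forall x y, qinner (T x) y = qinner x (T y).

Lemma qinner0r x : qinner x 0 = 0.
Proof. by rewrite -(scale0r (0 : H)) -qscale_real qinnerZr mulr0. Qed.

Lemma qinner0l x : qinner 0 x = 0.
Proof. by rewrite qinner_conj qinner0r /qconj /= oppr0. Qed.

Lemma qinnerDl x y z : qinner (x + y) z = qinner x z + qinner y z.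
Proof.
rewrite qinner_conj qinnerDr [in RHS]qinner_conj [X in _ = _ + X]qinner_conj.
by congr Quat => /=; rewrite opprD.
Qed.

Lemma adjoint_qsymmetric A : adjoint A = A -> qsymmetric A.
Proof.
rewrite /adjoint => AE.
have [h|h] := pselect (exists S,
    bounded_op S /\ forall x y, qinner (S x) y = qinner x (A y)).
  by have [_] := xgetPex (fun=> 0) h; rewrite AE.
(* Without an adjoint, [adjoint A] is the default 0, so [A] itself is 0 and symmetry is trivial. *)
move=> x y; rewrite -AE xgetPN; last by move=> S hS; apply: h; exists S.
by rewrite qinner0l qinner0r.
Qed.

Lemma qsymmetric_adjoint A : bounded_op A -> qsymmetric A -> adjoint A = A.
Proof.
move=> bA sA; apply: xget_unique => // S [_ SA].
apply/funext => x; apply/eqP; rewrite -subr_eq0 -sqr_norm_eq0 -ripxx.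
by rewrite ripBl /rip SA sA subrr.
Qed.

Lemma rip_sym A x y : qsymmetric A -> rip (A x) y = rip x (A y).
Proof. by rewrite /rip => ->. Qed.

Definition opshift T a := fun x => T x - a *: x.

(** The squared norm of the imaginary part. *)
Definition qim2 q := qi q ^+ 2 + qj q ^+ 2 + qk q ^+ 2.

Lemma qim2_ge0 q : 0 <= qim2 q.
Proof. by rewrite !addr_ge0 ?sqr_ge0. Qed.

Lemma qim2_eq0 q : qim2 q = 0 -> q = (qre q)%:q.
Proof.
case: q => a b c d; rewrite /qim2 /qreal /= => h.
have := sqr_ge0 b; have := sqr_ge0 c; have := sqr_ge0 d => d0 c0 b0.
by congr Quat; apply/eqP; rewrite -sqrf_eq0; apply/eqP; lra.
Qed.

Lemma bounded_op_opshift T a : bounded_op T -> bounded_op (opshift T a).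
Proof.
move=> bT; have := bounded_op_lincomb 1 (- a) bT (bounded_op_id H).
by congr bounded_op; apply/funext => x; rewrite scale1r scaleNr.
Qed.

Lemma qsymmetric_opshift T a : qsymmetric T -> qsymmetric (opshift T a).
Proof.
have qZl y z : qinner ((- a) *: y) z = qinner y ((- a) *: z).
  rewrite -!qscale_real qinnerZr [LHS]qinner_conj qinnerZr (qinner_conj y z).
  by case: (qinner z y) => *; congr Quat => /=; ring.
by move=> sT x y; rewrite /opshift -!scaleNr qinnerDl qinnerDr sT qZl.
Qed.

(** Completing the square. For symmetric [T] this exhibits [Qop q T] as a sum of two nonnegative
    operators. *)
Lemma QopE T q x : bounded_op T -> Qop q T x =
  opshift T (qre q) (opshift T (qre q) x) + qim2 q *: x.
Proof.
move=> bT; rewrite /Qop /opshift (bounded_opB bT) (bounded_opZ bT) !scalerBr.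
have -> : qnorm q ^+ 2 = qre q ^+ 2 + qim2 q.
  by rewrite /qnorm sqr_sqrtr ?addr_ge0 ?sqr_ge0// /qim2 !addrA.
rewrite mulr_natl mulr2n !scalerDl expr2 -scalerA opprB opprD !addrA.
by do 3 congr (_ + _); rewrite addrAC.
Qed.

Lemma Qop_real T a : bounded_op T -> Qop a%:q T = opshift T a \o opshift T a.
Proof.
move=> bT; apply/funext => x; rewrite QopE//= /qim2 /=.
by rewrite expr0n /= !addr0 scale0r addr0.
Qed.

Lemma bounded_op_Qop T q : bounded_op T -> bounded_op (Qop q T).
Proof.
move=> bT; pose A := opshift T (qre q).
have bA : bounded_op A by exact: bounded_op_opshift.
have := bounded_op_lincomb 1 (qim2 q) (bounded_op_comp bA bA) (bounded_op_id H).
by congr bounded_op; apply/funext => x; rewrite scale1r QopE.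
Qed.

Lemma rip_Qop T q x : bounded_op T -> qsymmetric T ->
  rip x (Qop q T x) = `|opshift T (qre q) x| ^+ 2 + qim2 q * `|x| ^+ 2.
Proof.
move=> bT sT; rewrite QopE// ripDr ripZr ripxx -rip_sym ?ripxx//.
exact: qsymmetric_opshift.
Qed.

Lemma opshift_invariant T a W : qsubmodule W -> invariant T W ->
  invariant (opshift T a) W.
Proof.
move=> Wm TW x Wx; apply: qsubmoduleB => //; first exact: TW.
exact: qsubmoduleZ.
Qed.

Lemma Qop_invariant T q W : bounded_op T -> qsubmodule W ->
  invariant T W -> invariant (Qop q T) W.
Proof.
move=> bT Wm TW x Wx; rewrite QopE//; have [_ WD _] := Wm.
by apply: WD; [do 2 apply: opshift_invariant => //|exact: qsubmoduleZ].
Qed.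

(** The assumed bound is exactly coercivity of the form of [Qop q T], so Lax-Milgram applies. *)
Lemma Qop_invertible_on T q W c : bounded_op T -> qsymmetric T ->
  closed_qsubmodule W -> invariant T W -> 0 < c ->
  (forall x, W x ->
    c * `|x| ^+ 2 <= `|opshift T (qre q) x| ^+ 2 + qim2 q * `|x| ^+ 2) ->
  invertible_on W (Qop q T).
Proof.
move=> bT sT Wm TW c0 Tc.
apply: (@lax_milgram _ _ _ _ c) => // [|x Wx].
  apply: bounded_opW; first exact: bounded_op_Qop.
  by apply: Qop_invariant => //; case: Wm.
by rewrite rip_Qop//; exact: Tc.
Qed.

(** A nonzero imaginary part makes the form of [Qop q T] coercive with constant [qim2 q]. *)
Lemma S_spectrum_on_real T W q : bounded_op T -> qsymmetric T ->
  closed_qsubmodule W -> invariant T W ->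
  S_spectrum_on W T q -> q = (qre q)%:q.
Proof.
move=> bT sT Wm TW sq; apply: qim2_eq0; apply: contrapT => q0; apply: sq.
apply: (@Qop_invertible_on _ _ _ (qim2 q)) => //.
  by rewrite lt0r qim2_ge0 andbT; exact/eqP.
by move=> x _; rewrite lerDr sqr_ge0.
Qed.

Lemma invertible_on_bounded_below W A : invertible_on W A ->
  (forall x, W x -> W (A x)) ->
  exists2 c, 0 < c & forall x, W x -> c * `|x| <= `|A x|.
Proof.
case=> S [bS SA] AW; have [M M0 SM] := bounded_op_onP bS.
exists M^-1; first by rewrite invr_gt0.
by move=> x Wx; rewrite ler_pdivrMl// -{1}(SA _ Wx).1; exact/SM/AW.
Qed.

(** With [A = opshift T a], a lower bound [c] for [A^2] and an upper bound [M] for [A] give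
    [c |x| <= |A (A x)| <= M |A x|]. *)
Lemma Qop_real_bounded_below T W a : bounded_op T ->
  qsubmodule W -> invariant T W -> invertible_on W (Qop a%:q T) ->
  exists2 c, 0 < c & forall x, W x -> c * `|x| <= `|opshift T a x|.
Proof.
move=> bT Wm TW iT.
have [//|c c0 cT] := invertible_on_bounded_below iT.
  exact: Qop_invariant.
have [M M0 TM] := bounded_op_onP (bounded_op_opshift a bT).
exists (c / M); first by rewrite divr_gt0.
move=> x Wx; rewrite mulrAC ler_pdivrMr// [leRHS]mulrC.
apply: le_trans (TM _ I).
by have := cT _ Wx; rewrite Qop_real.
Qed.

(** Surjectivity is componentwise; for the lower bound, each component is controlled by [A] on its
    summand, and the components of [A x] by [A x] through continuity of the projections. *)
Lemma invertible_on_direct_sum W1 W2 A : bounded_op A ->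
  topological_direct_sum W1 W2 -> invariant A W1 -> invariant A W2 ->
  invertible_on W1 A -> invertible_on W2 A -> invertible_on setT A.
Proof.
move=> bA [_ W12 [M WM]] AW1 AW2 i1 i2.
have [c1 c10 Ac1] := invertible_on_bounded_below i1 AW1.
have [c2 c20 Ac2] := invertible_on_bounded_below i2 AW2.
have M1 : 0 < `|M| + 1 by rewrite ltr_wpDl.
pose d := c1^-1 + c2^-1.
have d0 : 0 < d by rewrite addr_gt0 ?invr_gt0.
apply: (@invertible_onI _ _ _ _ ((d * (`|M| + 1))^-1)) => //.
- by rewrite invr_gt0 mulr_gt0.
- move=> x _; rewrite ler_pdivrMl ?mulr_gt0// -mulrA.
  have [x1 [x2 [Wx1 Wx2 ->]]] := W12 x; rewrite (bounded_opD bA).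
  have [h1 h2] := WM _ _ (AW1 _ Wx1) (AW2 _ Wx2).
  set n := `|A x1 + A x2| in h1 h2 *.
  have hM : M * n <= (`|M| + 1) * n.
    by rewrite ler_wpM2r ?normr_ge0// (le_trans (ler_norm M))// lerDl.
  rewrite (le_trans (ler_normD _ _))// mulrDl lerD// ler_pdivlMl//.
    by rewrite (le_trans (Ac1 _ Wx1))// (le_trans h1).
  by rewrite (le_trans (Ac2 _ Wx2))// (le_trans h2).
- move=> y _; have [y1 [y2 [Wy1 Wy2 ->]]] := W12 y.
  have [S1 [_ SA1]] := i1; have [S2 [_ SA2]] := i2.
  exists (S1 y1 + S2 y2) => //.
  by rewrite (bounded_opD bA) (SA1 _ Wy1).2 (SA2 _ Wy2).2.
Qed.

End Qop.

(** * Finite orthonormal families and finite-dimensional submodules *)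

Section FiniteDimension.
Variables (R : realType) (H : quatHilbertType R).
Implicit Types (x y z b : H) (W K : set H) (s t : seq H).

Lemma qnorm_sqr (q : quat R) : qre (qconj q * q) = qnorm q ^+ 2.
Proof. by rewrite /qnorm sqr_sqrtr ?addr_ge0 ?sqr_ge0//=; ring. Qed.

Lemma qnorm_conj (q : quat R) : qnorm (qconj q) = qnorm q.
Proof. by rewrite /qnorm /= !sqrrN. Qed.

Lemma qinnerNr x y : qinner x (- y) = - qinner x y.
Proof.
apply/eqP; rewrite -subr_eq0 opprK -qinnerDr addrC subrr.
by rewrite -(scale0r (0 : H)) -qscale_real qinnerZr mulr0.
Qed.

Lemma qinner_sumr (I : Type) (r : seq I) (F : I -> H) x :
  qinner x (\sum_(i <- r) F i) = \sum_(i <- r) qinner x (F i).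
Proof.
by elim: r => [|i r IH]; rewrite ?big_nil ?qinner0r// !big_cons qinnerDr IH.
Qed.

Lemma rip_sumr (I : Type) (r : seq I) (F : I -> H) x :
  rip x (\sum_(i <- r) F i) = \sum_(i <- r) rip x (F i).
Proof.
elim: r => [|i r IH]; last by rewrite !big_cons ripDr IH.
by rewrite !big_nil /rip qinner0r.
Qed.

(** For orthonormal [s], the orthogonal projection onto its span, written as a Fourier sum. *)
Definition qproj s x := \sum_(b <- s) qscale b (qinner b x).

Definition orthoseq s := uniq s /\ orthonormal [set` s].

Lemma norm_orthonormal (B : set H) b : orthonormal B -> B b -> `|b| ^+ 2 = 1.
Proof.
move=> oB Bb; have := oB _ _ Bb Bb; rewrite eqxx qinner_norm.
by case.
Qed.

Lemma qinner_qproj s x b : orthoseq s -> b \in s ->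
  qinner b (qproj s x) = qinner b x.
Proof.
move=> [us os] bs; rewrite qinner_sumr (bigD1_seq b)//= big_seq_cond big1.
  by rewrite addr0 qinnerZr os//= eqxx mul1r.
move=> e /andP[es eb]; rewrite qinnerZr os//= eq_sym (negbTE eb).
by rewrite mul0r.
Qed.

Lemma rip_qproj s x : rip x (qproj s x) = \sum_(b <- s) qnorm (qinner b x) ^+ 2.
Proof.
rewrite rip_sumr; apply: eq_bigr => b _.
by rewrite /rip qinnerZr qinner_conj qnorm_sqr.
Qed.

Lemma sqr_norm_qproj s x : orthoseq s ->
  `|qproj s x| ^+ 2 = \sum_(b <- s) qnorm (qinner b x) ^+ 2.
Proof.
move=> os; rewrite -ripxx [X in rip _ X]/qproj rip_sumr big_seq.
rewrite [RHS]big_seq; apply: eq_bigr => b bs.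
by rewrite /rip qinnerZr qinner_conj qinner_qproj// qnorm_sqr.
Qed.

Lemma bessel s x : orthoseq s ->
  \sum_(b <- s) qnorm (qinner b x) ^+ 2 <= `|x| ^+ 2.
Proof.
move=> os; have : 0 <= `|x - qproj s x| ^+ 2 by rewrite sqr_ge0.
by rewrite sqr_normB sqr_norm_qproj// rip_qproj; lra.
Qed.

Lemma bounded_op_qproj s : orthoseq s -> bounded_op (qproj s).
Proof.
move=> os; split=> // [x y _ _|x a _|].
- rewrite /qproj -big_split; apply: eq_bigr => b _ /=.
  by rewrite qinnerDr qscaleDl.
- rewrite /qproj; elim: s {os} => [|b s IH].
    by rewrite !big_nil -(scale0r (0 : H)) qscaleZl !scale0r.
  by rewrite !big_cons qscaleDr IH qinnerZr qscaleA.
exists 1 => x _; rewrite mul1r -ler_sqr ?nnegrE// sqr_norm_qproj//.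
exact: bessel.
Qed.

Lemma smallest_qsubmodule (B : set H) :
  qsubmodule (smallest (@qsubmodule R H) B).
Proof.
split=> [W [[]]//|x y Bx By W|x a Bx W] WB.
- by have [[_ WD _] _] := WB; apply: WD; [exact: Bx|exact: By].
- by have [[_ _ WZ] _] := WB; apply: WZ; exact: Bx.
Qed.

Lemma smallest_qsubmodule_qproj s x :
  smallest (@qsubmodule R H) [set` s] (qproj s x).
Proof.
have [S0 SD SZ] := smallest_qsubmodule [set` s].
rewrite /qproj big_seq; elim/big_ind : _ => // b bs.
by apply: SZ; exact: sub_gen_smallest.
Qed.

Lemma closed_qsubmodule_sub_smallest W (B : set H) : closed_qsubmodule W ->
  B `<=` W -> closure (smallest (@qsubmodule R H) B) `<=` W.
Proof.
move=> [Wm Wcl] BW; rewrite [X in _ `<=` X](closure_id W).1//.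
by apply: closureS; exact: smallest_sub.
Qed.

(** The kernel of [id - qproj s] is a closed submodule containing [s], hence containing the closed
    span [W]. *)
Lemma qproj_id s W x : orthoseq s -> orthonormal_basis W [set` s] -> W x ->
  qproj s x = x.
Proof.
move=> os [_ _ <-] Wx; pose A z := (-1) *: qproj s z + 1 *: z.
have bA : bounded_op A.
  exact: bounded_op_lincomb (bounded_op_qproj os) (bounded_op_id H).
have : op_ker A x.
  apply: closed_qsubmodule_sub_smallest Wx; first exact: closed_ker.
  move=> b /= bs; rewrite /op_ker /A /= scale1r scaleN1r; apply/eqP.
  rewrite addrC subr_eq0 /qproj (bigD1_seq b) ?os.1//= big_seq_cond big1.
    rewrite addr0 qinner_norm (norm_orthonormal os.2 bs).
    by rewrite qscale_real scale1r.
  move=> e /andP[es eb]; rewrite os.2// (negbTE eb).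
  by rewrite [0%:R](_ : _ = 0%:q) ?qscale_real ?scale0r.
rewrite /op_ker /A /= scale1r scaleN1r addrC => /eqP.
by rewrite subr_eq0 => /eqP.
Qed.

(* Parseval on one side and Bessel on the other, applied to the double sum of
   the |<b, e>|^2. *)
Lemma orthoseq_leq_size s t W : orthoseq s -> orthonormal_basis W [set` s] ->
  orthoseq t -> [set` t] `<=` W -> (size t <= size s)%N.
Proof.
move=> os bs ot tW; rewrite -(ler_nat R).
have szE (r : seq H) : (size r)%:R = \sum_(b <- r) (1 : R).
  by rewrite big_const_seq count_predT iter_addr_0.
rewrite !szE.
have -> : \sum_(e <- t) (1 : R) =
    \sum_(e <- t) \sum_(b <- s) qnorm (qinner b e) ^+ 2.
  rewrite big_seq [RHS]big_seq; apply: eq_bigr => e et.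
  rewrite -sqr_norm_qproj// (qproj_id os bs) ?(norm_orthonormal ot.2)//.
  exact: tW.
rewrite exchange_big big_seq [leRHS]big_seq /=; apply: ler_sum => b bs'.
rewrite -(norm_orthonormal os.2 bs') (le_trans _ (bessel b ot))//.
by rewrite ler_sum// => e _; rewrite (qinner_conj b e) qnorm_conj.
Qed.

Lemma finite_set_uniq_seq (B : set H) : finite_set B ->
  exists2 s, uniq s & B = [set` s].
Proof.
move=> /finite_seqP[s ->]; exists (undup s); first exact: undup_uniq.
by apply/seteqP; split => x /=; rewrite mem_undup.
Qed.

(** Orthonormal lists in [K] have bounded length. One of maximal length spans [K]: a nonzero
    residual [x - qproj t x], once normalized, would extend it. *)
Lemma finite_qdimS W K : finite_qdim W -> closed_qsubmodule K -> K `<=` W ->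
  finite_qdim K.
Proof.
move=> [B [bB /finite_set_uniq_seq[s us sE]]] cK KW; have [Km Kcl] := cK.
rewrite {}sE in bB.
have os : orthoseq s by split => //; case: bB.
pose P n := `[< exists t, [/\ orthoseq t, [set` t] `<=` K & size t = n] >].
have P0 : exists n, P n.
  by exists 0%N; apply/asboolP; exists [::].
have Ps n : P n -> (n <= size s)%N.
  move=> /asboolP[t [ot tK <-]]; apply: (orthoseq_leq_size os bB ot).
  exact: subset_trans tK KW.
have [n /asboolP[t [ot tK tn]] nmax] := ex_maxnP P0 Ps.
have tE x : K x -> qproj t x = x.
  move=> Kx; apply/eqP; apply: contrapT => /negP; rewrite eq_sym -subr_eq0.
  set y := x - _ => y0; pose e := `|y|^-1 *: y.
  have py : 0 < `|y| by rewrite normr_gt0.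
  have Kproj : K (qproj t x).
    apply: (closed_qsubmodule_sub_smallest cK tK).
    by apply: subset_closure; exact: smallest_qsubmodule_qproj.
  have Ke : K e by apply: qsubmoduleZ => //; exact: qsubmoduleB.
  have et b : b \in t -> qinner b e = 0.
    move=> bt; rewrite /e -qscale_real qinnerZr qinnerDr qinnerNr.
    by rewrite qinner_qproj// subrr mul0r.
  have te b : b \in t -> qinner e b = 0.
    by move=> /et h; rewrite qinner_conj h; congr Quat; rewrite oppr0.
  have ee : qinner e e = 1.
    rewrite qinner_norm /e normrZ ger0_norm ?invr_ge0// mulVf ?gt_eqF//.
    by rewrite expr1n.
  have eNt : e \notin t.
    apply/negP => /et; rewrite ee => /eqP.
    by rewrite oner_eq0.
  have : (n.+1 <= n)%N.
    apply: nmax; apply/asboolP; exists (e :: t); split=> /=; last by rewrite tn.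
      split=> /=; first by rewrite eNt ot.1.
      move=> u v /=; rewrite !inE => /predU1P[->|ut] /predU1P[->|vt].
      - by rewrite eqxx.
      - by rewrite te// eq_sym; have /negbTE -> := memPn eNt _ vt.
      - by rewrite et//; have /negbTE -> := memPn eNt _ ut.
      - exact: ot.2.
    by move=> u /=; rewrite inE => /predU1P[->//|]; exact: tK.
  by rewrite ltnn.
exists [set` t]; split; last exact: finite_seq.
split=> //; first by case: ot.
apply/seteqP; split; first exact: closed_qsubmodule_sub_smallest.
move=> x Kx; apply: subset_closure; rewrite -(tE x Kx).
exact: smallest_qsubmodule_qproj.
Qed.

End FiniteDimension.

(** * Spectral calculus: scalar measures, commutation with [T], and bounds on spectral subspaces *)

Section SpectralMeasure.
Variables (R : realType) (H : quatHilbertType R) (T : H -> H).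
Variable E : set R -> H -> H.
Hypotheses (bT : bounded_op T) (sT : qsymmetric T) (sE : spectral_measure T E).
Implicit Types (x y u v : H) (B C : set R) (a d l m t : R).

Lemma bounded_op_pvm B : measurable B -> bounded_op (E B).
Proof. by case: sE => -[hE _ _ _] _ /hE[]. Qed.

Lemma qsymmetric_pvm B : measurable B -> qsymmetric (E B).
Proof.
by case: sE => -[hE _ _ _] _ /hE[_ _ hB]; exact: adjoint_qsymmetric.
Qed.

Lemma pvm_setI B C x : measurable B -> measurable C ->
  E (B `&` C) x = E B (E C x).
Proof. by case: sE => -[_ _ hI _] _ mB mC; rewrite hI. Qed.

Lemma pvm_idem B x : measurable B -> E B (E B x) = E B x.
Proof. by move=> mB; rewrite -pvm_setI// setIid. Qed.

Lemma pvm_setT x : E setT x = x.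
Proof. by case: sE => -[_ -> _ _] _. Qed.

Lemma rip_pvm B x : measurable B -> rip x (E B x) = `|E B x| ^+ 2.
Proof.
by move=> mB; rewrite -ripxx rip_sym ?pvm_idem//; exact: qsymmetric_pvm.
Qed.

Lemma exists_spectral_measure_at x : exists mu : {measure set R -> \bar R},
  [/\ forall B, measurable B -> mu B = (`|E B x| ^+ 2)%:E,
      mu.-integrable setT (fun t : R => t%:E) &
      rip x (T x) = \int[mu]_t t].
Proof.
case: sE => _ /(_ x)[mu [muE imu Tx]]; exists mu; split => //; last first.
  by rewrite /rip Tx.
move=> B mB; have [qB muB] := muE _ mB.
rewrite -(rip_pvm x mB) /rip qB /= fineK// ge0_fin_numE//.
Qed.

(** The scalar spectral measure of [x], through which measure theory is applied to [E]. *)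
Definition mu_at x := sval (cid (exists_spectral_measure_at x)).

Lemma mu_atE x B : measurable B -> mu_at x B = (`|E B x| ^+ 2)%:E.
Proof. by rewrite /mu_at; case: cid => mu [/= + _ _]; exact. Qed.

Lemma mu_at_integrable x : (mu_at x).-integrable setT (fun t : R => t%:E).
Proof. by rewrite /mu_at; case: cid => mu []. Qed.

Lemma integrable_cst_mu_at x B a : measurable B ->
  (mu_at x).-integrable B (cst a%:E).
Proof.
move=> mB; apply/integrableP; split; first exact: measurable_cst.
by rewrite /= integral_cst// mu_atE// -EFinM ltry.
Qed.

Lemma rip_mu_at x : rip x (T x) = \int[mu_at x]_t t.
Proof. by rewrite /mu_at; case: cid => mu []. Qed.

Lemma pvm_set0 x : E set0 x = 0.
Proof.
apply/eqP; rewrite -sqr_norm_eq0 -eqe -mu_atE//.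
by rewrite measure0.
Qed.

Lemma pvm_bigcup0 x (F : nat -> set R) : (forall n, measurable (F n)) ->
  (forall n, E (F n) x = 0) -> E (\bigcup_n F n) x = 0.
Proof.
move=> mF F0; apply/eqP; rewrite -sqr_norm_eq0 -eqe.
have mU : measurable (\bigcup_n F n) by exact: bigcupT_measurable.
rewrite -mu_atE//; apply/eqP/negligibleP => //.
apply: negligible_bigcup => n; apply/negligibleP => //.
by apply: etrans (mu_atE x (mF n)) _; rewrite F0 normr0 expr0n.
Qed.

(** Continuity from above of the finite measure [mu_at x]. *)
Lemma pvm_small x (F : nat -> set R) e : (forall n, measurable (F n)) ->
  nonincreasing_seq F -> \bigcap_n F n = set0 -> 0 < e ->
  exists n, `|E (F n) x| < e.
Proof.
move=> mF dF F0 e0.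
have : mu_at x \o F @ \oo --> mu_at x (\bigcap_n F n).
  apply: nonincreasing_cvg_mu => //; last exact: bigcapT_measurable.
  by rewrite mu_atE// ltry.
rewrite F0 measure0 => /fine_cvgP[_ /cvgrPdist_lt/(_ (e ^+ 2))].
rewrite exprn_gt0// => /(_ isT)[n _ /(_ n (leqnn n))] /=.
rewrite sub0r normrN mu_atE//= ger0_norm ?sqr_ge0// => h.
by exists n; rewrite -ltr_sqr ?nnegrE ?(ltW e0).
Qed.

Lemma pvm_compl B x : measurable B -> x - E B x = E (~` B) x.
Proof.
move=> mB; have mC : measurable (~` B) by exact: measurableC.
have bB := bounded_op_pvm mB; have bC := bounded_op_pvm mC.
set y := x - E B x.
have By : E B y = 0 by rewrite /y (bounded_opB bB) pvm_idem// subrr.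
have yE : E (~` B) y = E (~` B) x.
  by rewrite /y (bounded_opB bC) -pvm_setI// setICl pvm_set0 subr0.
rewrite -yE; apply/eqP; rewrite -subr_eq0 -sqr_norm_eq0 sqr_normB rip_pvm//.
have : mu_at y setT = (mu_at y B + mu_at y (~` B))%E.
  by rewrite -measureU ?setUv ?setICr.
rewrite !mu_atE// pvm_setT By normr0 expr0n /= add0e => -[->].
by apply/eqP; ring.
Qed.

Lemma pvm_add_compl B x : measurable B -> E B x + E (~` B) x = x.
Proof. by move=> mB; rewrite -pvm_compl// addrC subrK. Qed.

Lemma pvm_compl_eq0 B x : measurable B -> E B x = x -> E (~` B) x = 0.
Proof. by move=> mB xB; rewrite -pvm_compl// xB subrr. Qed.

Lemma pvm_ortho B x y : measurable B -> rip (E B x) (E (~` B) y) = 0.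
Proof.
move=> mB; have mC : measurable (~` B) by exact: measurableC.
rewrite rip_sym; last exact: qsymmetric_pvm.
by rewrite -pvm_setI// setICr pvm_set0 /rip qinner0r.
Qed.

Lemma pvm_pythagoras B x : measurable B ->
  `|x| ^+ 2 = `|E B x| ^+ 2 + `|E (~` B) x| ^+ 2.
Proof.
move=> mB; rewrite -{1}(pvm_add_compl x mB).
by rewrite sqr_normD pvm_ortho// mulr0 addr0.
Qed.

Lemma norm_pvm B x : measurable B -> `|E B x| <= `|x|.
Proof.
move=> mB; rewrite -ler_sqr ?nnegrE// (pvm_pythagoras x mB) lerDl.
exact: sqr_ge0.
Qed.

Lemma pvm_sub B C x : measurable B -> measurable C -> B `<=` C ->
  E C (E B x) = E B x.
Proof. by move=> mB mC BC; rewrite -pvm_setI// setIidr. Qed.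

(** The scalar measure of [E B x] is that of [x] restricted to [B]: it vanishes off [B] and agrees
    with [mu_at x] on subsets of [B]. *)
Lemma pvm_form B x : measurable B ->
  rip (E B x) (T (E B x)) = \int[mu_at x]_(t in B) t.
Proof.
move=> mB; have mC : measurable (~` B) by exact: measurableC.
rewrite rip_mu_at /Rintegral; congr fine.
rewrite (negligible_integral mC measurableT (mu_at_integrable _)); last first.
  by rewrite mu_atE// -pvm_setI// setICl pvm_set0 normr0 expr0n.
rewrite setTD setCK; apply: eq_measure_integral => A mA AB.
by rewrite !mu_atE// -pvm_setI// setIidl.
Qed.

Lemma pvm_form_split B x : measurable B -> rip x (T x) =
  rip (E B x) (T (E B x)) + rip (E (~` B) x) (T (E (~` B) x)).
Proof.
move=> mB; have mC : measurable (~` B) by exact: measurableC.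
rewrite !pvm_form// rip_mu_at -Rintegral_setU ?setUv//.
  exact: mu_at_integrable.
by apply/disj_setPS; rewrite setICr.
Qed.

(* The form of T splits along E(B) + E(B^c), so its cross term vanishes; take
   the cross term of E(B) (T v) and v. *)
Lemma pvm_T_compl B v : measurable B -> E (~` B) v = v -> E B (T v) = 0.
Proof.
move=> mB vC; have mC : measurable (~` B) by exact: measurableC.
set u := E B (T v).
have Bu : E B u = u by rewrite /u pvm_idem.
have Cu : E (~` B) u = 0 by exact: pvm_compl_eq0.
have Bv : E B v = 0 by rewrite -vC -pvm_setI// setICr pvm_set0.
have := pvm_form_split (u + v) mB.
rewrite (bounded_opD (bounded_op_pvm mB)) (bounded_opD (bounded_op_pvm mC)).
rewrite Bu Cu Bv vC addr0 add0r (bounded_opD bT) !(ripDl, ripDr).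
rewrite -(rip_sym v u sT) (ripC (T v)) => h.
have : rip u (T v) = 0 by lra.
by rewrite ripC rip_pvm// => /eqP; rewrite sqr_norm_eq0 => /eqP.
Qed.

(** The vanishing of [E B (T v)] is used for [B] and for its complement, so that [T] preserves both
    ranges. *)
Lemma pvm_commute B x : measurable B -> E B (T x) = T (E B x).
Proof.
move=> mB; have mC : measurable (~` B) by exact: measurableC.
have bB := bounded_op_pvm mB.
rewrite -{1}(pvm_add_compl x mB) (bounded_opD bT) (bounded_opD bB).
rewrite (pvm_T_compl (v := E (~` B) x))// ?pvm_idem// addr0.
apply/esym/eqP; rewrite -subr_eq0 pvm_compl// pvm_T_compl//.
by rewrite setCK pvm_idem.
Qed.

Lemma pvm_opshift B a x : measurable B ->
  E B (opshift T a x) = opshift T a (E B x).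
Proof.
move=> mB; have bB := bounded_op_pvm mB.
by rewrite /opshift (bounded_opB bB) (bounded_opZ bB) pvm_commute.
Qed.

Lemma pvm_Qop B q x : measurable B -> E B (Qop q T x) = Qop q T (E B x).
Proof.
move=> mB; have bB := bounded_op_pvm mB.
by rewrite !QopE// (bounded_opD bB) (bounded_opZ bB) !pvm_opshift.
Qed.

(** The range of [E B], described by fixed vectors so that membership is an equation to rewrite
    with. *)
Definition spectral_space B := [set x | E B x = x].

Lemma spectral_space_pvm B x : measurable B -> spectral_space B (E B x).
Proof. exact: pvm_idem. Qed.

Lemma spectral_space_range B : measurable B -> spectral_space B = range (E B).
Proof.
move=> mB; apply/seteqP; split=> [x <-|_ [x _ <-]]; first by exists x.
exact: spectral_space_pvm.
Qed.

Lemma closed_spectral_space B : measurable B ->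
  closed_qsubmodule (spectral_space B).
Proof.
move=> mB; have := closed_ker (bounded_op_pvm (measurableC mB)).
congr closed_qsubmodule; apply/seteqP; split=> x; rewrite /op_ker /=.
  by rewrite -pvm_compl// => /eqP; rewrite subr_eq0 => /eqP.
exact: pvm_compl_eq0.
Qed.

Lemma spectral_space_invariant B : measurable B ->
  invariant T (spectral_space B).
Proof. by move=> mB x Bx; rewrite /spectral_space /= pvm_commute// Bx. Qed.

Lemma spectral_lower B a x : measurable B -> (forall t, B t -> a <= t) ->
  spectral_space B x -> a * `|x| ^+ 2 <= rip x (T x).
Proof.
move=> mB aB xB; rewrite -{2 3}xB pvm_form//.
have -> : a * `|x| ^+ 2 = \int[mu_at x]_(t in B) a.
  by rewrite Rintegral_cst// mu_atE//= xB.
apply: le_Rintegral => //.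
  exact: integrable_cst_mu_at.
exact: (integrableS measurableT mB (@subsetT _ _) (mu_at_integrable x)).
Qed.

Lemma spectral_upper B a x : measurable B -> (forall t, B t -> t <= a) ->
  spectral_space B x -> rip x (T x) <= a * `|x| ^+ 2.
Proof.
move=> mB aB xB; rewrite -{1 2}xB pvm_form//.
have -> : a * `|x| ^+ 2 = \int[mu_at x]_(t in B) a.
  by rewrite Rintegral_cst// mu_atE//= xB.
apply: le_Rintegral => //.
  exact: (integrableS measurableT mB (@subsetT _ _) (mu_at_integrable x)).
exact: integrable_cst_mu_at.
Qed.

(** The form of [T - l] is at least [d] on the part of [B] above [l] and at most [-d] on the part
    below. Cauchy-Schwarz bounds the operator on each part, and Pythagoras recombines them. *)
Lemma spectral_space_opshift_lower B l d x : measurable B -> 0 <= d ->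
  (forall t, B t -> d <= `|t - l|) -> spectral_space B x ->
  d * `|x| <= `|opshift T l x|.
Proof.
move=> mB d0 Bd xB.
pose C : set R := `[l, +oo[%classic.
have mC : measurable C by exact: measurable_itv.
have mC' : measurable (~` C) by exact: measurableC.
rewrite ler_norm_sqrl// (pvm_pythagoras (opshift T l x) mC).
rewrite (pvm_pythagoras x mC).
rewrite mulrDr !pvm_opshift//; apply: lerD; rewrite -ler_norm_sqrl//.
- set y := E C x; have [->|y0] := eqVneq y 0; first by rewrite normr0 mulr0.
  have yBC : spectral_space (C `&` B) y.
    have <- : E (C `&` B) x = y by rewrite pvm_setI// xB.
    by apply: spectral_space_pvm; exact: measurableI.
  have Bl t : (C `&` B) t -> d + l <= t.
    move=> [+ /Bd]; rewrite /C /= in_itv/= andbT => lt.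
    by rewrite ger0_norm ?subr_ge0// lerBrDr.
  have := spectral_lower (measurableI _ _ mC mB) Bl yBC => h.
  rewrite -(ler_pM2l (_ : 0 < `|y|)) ?normr_gt0//.
  apply: le_trans (rip_cauchy_schwarz _ _).
  by rewrite /opshift ripBr ripZr ripxx; lra.
- set y := E (~` C) x; have [->|y0] := eqVneq y 0.
    by rewrite normr0 mulr0.
  have yBC : spectral_space (~` C `&` B) y.
    have <- : E (~` C `&` B) x = y by rewrite pvm_setI// xB.
    by apply: spectral_space_pvm; exact: measurableI.
  have Bl t : (~` C `&` B) t -> t <= l - d.
    move=> [+ /Bd]; rewrite /C /= in_itv/= andbT => /negP; rewrite -ltNge => tl.
    rewrite ler0_norm ?subr_le0 ?(ltW tl)//; lra.
  have := spectral_upper (measurableI _ _ mC' mB) Bl yBC => h.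
  rewrite -(ler_pM2l (_ : 0 < `|y|)) ?normr_gt0//.
  rewrite -[`|opshift _ _ _|]normrN.
  apply: le_trans (rip_cauchy_schwarz _ _).
  by rewrite ripNr /opshift ripBr ripZr ripxx; lra.
Qed.

(* The quadratic form of T - m is bounded by d on the spectral space;
   polarizing it at x and d^-1 (T - m) x bounds the operator itself. *)
Lemma spectral_space_opshift_upper B m d x : measurable B -> 0 < d ->
  (forall t, B t -> `|t - m| <= d) -> spectral_space B x ->
  `|opshift T m x| <= d * `|x|.
Proof.
move=> mB d0 Bd xB; have [[_ WD _] _] := closed_spectral_space mB.
have form y : spectral_space B y -> `|rip y (opshift T m y)| <= d * `|y| ^+ 2.
  move=> yB; rewrite /opshift ripBr ripZr ripxx.
  have Bl t : B t -> m - d <= t by move=> /Bd; rewrite ler_distl => /andP[].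
  have Bu t : B t -> t <= m + d by move=> /Bd; rewrite ler_distl => /andP[].
  have := spectral_lower mB Bl yB; have := spectral_upper mB Bu yB => h1 h2.
  rewrite ler_norml; apply/andP; split; lra.
set z := opshift T m x.
have zB : spectral_space B z by rewrite /spectral_space /= /z pvm_opshift// xB.
have Wm := (closed_spectral_space mB).1.
have bA := bounded_op_opshift m bT; have sA := qsymmetric_opshift m sT.
have dz : spectral_space B (d^-1 *: z) by exact: qsubmoduleZ.
have := form _ (WD _ _ xB dz); have := form _ (qsubmoduleB Wm xB dz).
rewrite !ler_norml => /andP[h1 _] /andP[_ h2].
have : rip (x + d^-1 *: z) (opshift T m (x + d^-1 *: z)) -
    rip (x - d^-1 *: z) (opshift T m (x - d^-1 *: z)) = 4 * d^-1 * `|z| ^+ 2.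
  rewrite (bounded_opD bA) (bounded_opB bA) (bounded_opZ bA) -/z.
  have := rip_sym x z sA; rewrite -/z; move: (opshift T m z) => w xw.
  clearbody z.
  rewrite !(ripDl, ripDr, ripBl, ripBr, ripZl, ripZr, ripNl, ripNr).
  by rewrite -xw ripxx; ring.
move: h1 h2; rewrite sqr_normB sqr_normD normrZ exprMn.
rewrite ger0_norm ?invr_ge0 ?(ltW d0)// => h1 h2 h3.
have h4 : d * (d^-1 ^+ 2 * `|z| ^+ 2) = d^-1 * `|z| ^+ 2.
  by rewrite expr2 !mulrA divff ?gt_eqF// mul1r.
have h5 : d^-1 * `|z| ^+ 2 <= d * `|x| ^+ 2 by lra.
by rewrite (ler_norm_sqrr _ _ (ltW d0)) expr2 -mulrA -ler_pdivrMl.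
Qed.

(** Together with [far l n] this partitions the complement of [l]; the radius is [1/(n+1)], so that
    [n = 0] is allowed. *)
Definition punct l (n : nat) : set R :=
  `]l - n.+1%:R^-1, l + n.+1%:R^-1[ `\` [set l].

Definition far l (n : nat) : set R := ~` `]l - n.+1%:R^-1, l + n.+1%:R^-1[.

Lemma measurable_punct l n : measurable (punct l n).
Proof.
by apply: measurableD; [exact: measurable_itv|exact: measurable_set1].
Qed.

Lemma measurable_far l n : measurable (far l n).
Proof. by apply: measurableC; exact: measurable_itv. Qed.

Lemma measurable_setC1 l : measurable (~` [set l]).
Proof. by apply: measurableC; exact: measurable_set1. Qed.

Lemma far_sub l n : far l n `<=` ~` [set l].
Proof.
move=> t ft tl; apply: ft; rewrite /= tl in_itv /= gtrBl ltrDl.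
by rewrite invr_gt0 ltr0n.
Qed.

(** The punctured intervals decrease to the empty set. *)
Lemma pvm_punct_small l x e : 0 < e -> exists n, `|E (punct l n) x| < e.
Proof.
apply: pvm_small; first exact: measurable_punct.
  move=> m n mn; apply/subsetPset => t; rewrite /punct /= !in_itv/=.
  move=> [/andP[t1 t2] tl].
  have h : n.+1%:R^-1 <= m.+1%:R^-1 :> R.
    by rewrite lef_pV2 ?posrE ?ltr0n// ler_nat.
  move: (n.+1%:R^-1) (m.+1%:R^-1) h t1 t2 => p q pq t1 t2.
  by split => //; apply/andP; split; lra.
rewrite -subset0 => t /= ht.
have tl : 0 < `|t - l|.
  by rewrite normr_gt0 subr_eq0; apply/eqP; have [] := ht 0%N I.
have [n nt] : exists n, n.+1%:R^-1 < `|t - l| :> R.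
  exists (Num.truncn (`|t - l|^-1)).
  by rewrite invf_plt ?posrE ?ltr0n// truncnS_gt.
have [] := ht n I; rewrite /= in_itv/= -ltr_distl.
by rewrite ltNge (ltW nt).
Qed.

Lemma pvm_far_punct l n x : spectral_space (~` [set l]) x ->
  x - E (far l n) x = E (punct l n) x.
Proof.
move=> xl; rewrite pvm_compl; last exact: measurable_far.
rewrite -[in LHS]xl -pvm_setI//; last exact: measurable_setC1.
  by rewrite /far setCK.
by apply: measurableC; exact: measurable_far.
Qed.

Lemma spectral_space_far_lower l n x : spectral_space (far l n) x ->
  n.+1%:R^-1 * `|x| <= `|opshift T l x|.
Proof.
apply: spectral_space_opshift_lower; first exact: measurable_far.
  by rewrite invr_ge0.
by move=> t; rewrite /far /= in_itv /= -ltr_distl => /negP; rewrite -leNgt.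
Qed.

(** On the right-hand space [T - l] is bounded by every [d > 0]. Conversely, the component of a
    kernel vector off [l] lives on every [punct l n], hence has arbitrarily small norm. *)
Lemma ker_opshift l : op_ker (opshift T l) = spectral_space [set l].
Proof.
have ml : measurable [set l] by exact: measurable_set1.
apply/seteqP; split=> x; last first.
  move=> xl; rewrite /op_ker /=; apply/eqP; rewrite -normr_le0.
  apply/ler_addgt0Pl => e e0; rewrite addr0.
  pose d := e / (`|x| + 1).
  have x1 : 0 < `|x| + 1 by rewrite ltr_wpDl.
  have d0 : 0 < d by rewrite divr_gt0.
  apply: le_trans (spectral_space_opshift_upper ml d0 _ xl) _.
    by move=> t /= ->; rewrite subrr normr0 ltW.
  by rewrite /d mulrAC ler_pdivrMr// ler_wpM2l ?ltW// ltrDl.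
move=> xl; have bE := bounded_op_pvm (measurableC ml).
rewrite /spectral_space /=; apply/eqP; rewrite eq_sym -subr_eq0 pvm_compl//.
set v := E (~` _) x.
have vl : spectral_space (~` [set l]) v by exact/spectral_space_pvm/measurableC.
have vk : opshift T l v = 0.
  by rewrite /v -pvm_opshift ?xl ?bounded_op0//; exact: measurableC.
rewrite -normr_le0; apply/ler_addgt0Pl => e e0; rewrite addr0.
have [n En] := pvm_punct_small l v e0.
(* [E (far l n) v] is again in the kernel, but [T - l] is bounded below on that space, so it is
   0. *)
have -> : v = E (punct l n) v.
  rewrite -pvm_far_punct//; have mf := measurable_far l n.
  have : spectral_space (far l n) (E (far l n) v) by exact: spectral_space_pvm.
  move=> /(spectral_space_far_lower) /=.
  rewrite -pvm_opshift// vk (bounded_op0 (bounded_op_pvm mf)) normr0.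
  by rewrite pmulr_rle0 ?invr_gt0// normr_le0 => /eqP ->; rewrite subr0.
exact: ltW.
Qed.

End SpectralMeasure.

(** * The real line inside the quaternions *)

Section QuatTopology.
Variable R : realType.

Lemma continuous_qre : continuous (@qre R).
Proof.
move=> q; have -> : @qre R = (fst \o fst \o fst) \o @quat_coords R by [].
apply: continuous_comp; first exact: initial_continuous.
by do 2 (apply: continuous_comp; first exact: cvg_fst); exact: cvg_fst.
Qed.

Lemma continuous_qreal : continuous (@qreal R).
Proof.
apply: (@continuous_comp_initial _ _ _ (@quat_coords R)) => a.
have z : (fun=> 0) @ a --> (0 : R) by exact: cvg_cst.
exact: (cvg_pair (cvg_pair (cvg_pair (@cvg_id _ (nbhs a)) z) z) z).
Qed.

Lemma qsphere_real (a : R) : qsphere a%:q = [set a%:q].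
Proof.
have im0 : qnorm (qim a%:q) = 0.
  by rewrite /qnorm /qim /= !subr0 subrr expr0n /= !addr0 sqrtr0.
rewrite /qsphere im0; apply/seteqP; split=> q /=.
  by move=> [I [_ ->]]; rewrite mulr0 addr0.
(* Any imaginary unit serves, since it is multiplied by 0. *)
move=> ->; exists (Quat 0 1 0 0); split; last by rewrite mulr0 addr0.
by congr Quat => /=; ring.
Qed.

End QuatTopology.

(** * Spectrum of [T] versus support of [E] *)

Section SpectrumGap.
Variables (R : realType) (H : quatHilbertType R) (T : H -> H).
Variable E : set R -> H -> H.
Hypotheses (bT : bounded_op T) (sT : qsymmetric T) (sE : spectral_measure T E).
Implicit Types (x y u v : H) (B C : set R) (a d l m t : R).

(** The spectrum is real, so isolation among quaternions amounts to isolation on the real line. *)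
Lemma isolated_spectrumP l : isolated (S_spectrum T) l%:q <->
  S_spectrum T l%:q /\
  exists2 e, 0 < e & forall a, 0 < `|a - l| < e -> ~ S_spectrum T a%:q.
Proof.
split=> [[/set_mem sl [V Vl Vs]]|[sl [e e0 He]]].
  split => //; have /nbhs_ballP[e e0 eV] := @continuous_qreal R l _ Vl.
  exists e => // a /andP[al ale] sa.
  have : (V `&` S_spectrum T) a%:q.
    by split => //; apply: eV; rewrite -ball_normE /= distrC.
  by rewrite Vs => -[] ae; move: al; rewrite ae subrr normr0 ltxx.
split; first exact: mem_set.
exists (@qre R @^-1` ball l e).
  by apply: (@continuous_qre R l%:q); exact: nbhsx_ballx.
apply/seteqP; split=> [q [/= ql sq]|_ ->]; last by split => //; exact: ballxx.
have qE : q = (qre q)%:q.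
  by apply: (S_spectrum_on_real bT sT _ _ sq).
rewrite qE; congr qreal; apply/eqP; rewrite -subr_eq0 -normr_le0 leNgt.
apply/negP => q0; rewrite qE in sq; apply: He sq.
by rewrite q0 /=; move: ql; rewrite -ball_normE /= distrC.
Qed.

(** [T - m] is bounded below by some [c] everywhere, but above by [c / 2] on the spectral space of
    the interval of radius [c / 2], which must therefore be zero. *)
Lemma pvm_resolvent m : ~ S_spectrum T m%:q ->
  exists2 d, 0 < d & forall x, E `]m - d, m + d[ x = 0.
Proof.
move=> /contrapT im.
have [//|c c0 cT] := Qop_real_bounded_below bT (@qsubmoduleT R H) _ im.
have mB : measurable (`]m - c / 2, m + c / 2[ : set R) by exact: measurable_itv.
exists (c / 2) => [|x]; first by rewrite divr_gt0.
set y := E _ x; have yB := spectral_space_pvm sE x mB.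
have : `|opshift T m y| <= c / 2 * `|y|.
  apply: (spectral_space_opshift_upper bT sT sE mB _ _ yB).
    by rewrite divr_gt0.
  by move=> t /=; rewrite in_itv /= -ltr_distl => /ltW.
move=> /(le_trans (cT y I)); rewrite -subr_ge0 -mulrBl.
have -> : c / 2 - c = - (c / 2) by lra.
by rewrite mulNr oppr_ge0 pmulr_rle0 ?divr_gt0// normr_le0 => /eqP.
Qed.

(* Cover B by the countably many rational intervals on which E vanishes. *)
Lemma pvm_resolvent_set B x : measurable B ->
  (forall m, B m -> ~ S_spectrum T m%:q) -> E B x = 0.
Proof.
move=> mB Bres.
pose J (p : rat * rat) : set R := `]ratr p.1, ratr p.2[%classic.
have mJ p : measurable (J p) by exact: measurable_itv.
(* An enumeration by codes; non-codes, and intervals on which [E] does not vanish, contribute the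
   empty set. *)
pose F n : set R := if @unpickle (rat * rat)%type n is Some p then
  if `[< forall y, E (J p) y = 0 >] then J p else set0 else set0.
have mF n : measurable (F n) by rewrite /F; case: unpickle => // p; case: ifP.
have F0 n : E (F n) x = 0.
  rewrite /F; case: unpickle => [p|]; last exact: (pvm_set0 sE).
  by case: ifPn => [/asboolP -> //|_]; exact: (pvm_set0 sE).
have BF : B `<=` \bigcup_n F n.
  move=> m /Bres/pvm_resolvent[d d0 Ed].
  have lm : m - d < m by rewrite gtrBl.
  have um : m < m + d by rewrite ltrDl.
  have [r] := rat_in_itvoo lm.
  rewrite in_itv /= => /andP[r1 r2].
  have [s] := rat_in_itvoo um.
  rewrite in_itv /= => /andP[s1 s2].
  exists (pickle (r, s)); first exact: I.
  rewrite /F pickleK; case: ifPn => [_|].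
    by rewrite /J /= in_itv /= r2 s1.
  move=> /asboolP; case=> y.
  have Jm : J (r, s) `<=` `]m - d, m + d[.
    move=> t; rewrite /J /= !in_itv /= => /andP[t1 t2].
    by rewrite (lt_trans r1)//= (lt_trans t2).
  have mm : measurable (`]m - d, m + d[ : set R) by exact: measurable_itv.
  by rewrite -(pvm_sub sE y (mJ (r, s)) mm Jm); exact: Ed.
have mU : measurable (\bigcup_n F n) by exact: bigcupT_measurable.
by rewrite -(setIidl BF) (pvm_setI sE)// (pvm_bigcup0 sE)//
  (bounded_op0 (bounded_op_pvm sE mB)).
Qed.

(** By symmetry the form of [Qop l%:q T] at [x] is [|(T - l) x|^2], so squaring does not enlarge the
    kernel. *)
Lemma op_ker_Qop l : op_ker (Qop l%:q T) = spectral_space E [set l].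
Proof.
rewrite -(ker_opshift bT sT sE); apply/seteqP; split=> x; rewrite /op_ker /=.
  move=> Qx; have := rip_Qop l%:q x bT sT; rewrite Qx /rip qinner0r /=.
  rewrite /qim2 /= expr0n /= !addr0 mul0r addr0 => /esym/eqP.
  by rewrite sqr_norm_eq0 => /eqP.
by rewrite Qop_real//= => ->; rewrite bounded_op0//; exact: bounded_op_opshift.
Qed.

Lemma Qop_invertible_on_far l n :
  invertible_on (spectral_space E (far l n)) (Qop l%:q T).
Proof.
have mf := measurable_far l n.
apply: (@Qop_invertible_on _ _ _ _ _ (n.+1%:R^-1 ^+ 2)) => //.
- exact: (closed_spectral_space sE).
- exact: (spectral_space_invariant bT sT sE).
- move=> x xf /=; rewrite /qim2 /= expr0n /= !addr0 mul0r addr0.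
  by rewrite -ler_norm_sqrl ?invr_ge0//;
    exact: (spectral_space_far_lower bT sT sE).
Qed.

End SpectrumGap.

(** * The implications between the four conditions *)

Section Implications.
Variables (R : realType) (H : quatHilbertType R) (T : H -> H).
Variable E : set R -> H -> H.
Hypotheses (bT : bounded_op T) (sT : qsymmetric T) (sE : spectral_measure T E).
Variable l : R.
Hypothesis sl : S_spectrum T l%:q.

(** [Qop l%:q T] is self-adjoint, so its two kernel conditions coincide. *)
Lemma Fredholm_QopP : Fredholm (Qop l%:q T) <->
  closed (range (Qop l%:q T)) /\ finite_qdim (spectral_space E [set l]).
Proof.
have bQ : bounded_op (Qop l%:q T) by exact: bounded_op_Qop.
have sQ : qsymmetric (Qop l%:q T).
  have sA := qsymmetric_opshift l sT.
  by move=> x y; rewrite Qop_real//= !sA.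
rewrite /Fredholm qsymmetric_adjoint// (op_ker_Qop bT sT sE).
by split=> [[_ ?]|[]].
Qed.

Lemma isolated_finite_rank_Fredholm :
  isolated (S_spectrum T) l%:q /\ finite_qdim (range (E [set l])) ->
  ~ essential_S_spectrum T l%:q.
Proof.
have ml : measurable [set l] by exact: measurable_set1.
move=> [/(isolated_spectrumP bT sT)[_ [e e0 He]]].
rewrite -(spectral_space_range sE ml) => fl; apply.
apply/Fredholm_QopP; split=> //.
have [n ne] : exists n, n.+1%:R^-1 < e :> R.
  exists (Num.truncn e^-1).
  by rewrite invf_plt ?posrE ?ltr0n// truncnS_gt.
have p0 x : E (punct l n) x = 0.
  apply: (pvm_resolvent_set bT sT sE); first exact: measurable_punct.
  move=> m [/=]; rewrite in_itv /= -ltr_distl => ml' mln; apply: He.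
  rewrite (lt_trans ml' ne) andbT normr_gt0 subr_eq0; exact/eqP.
(* Since [E] vanishes on [punct l n], the complement of this space is the kernel, and on the space
   itself the operator is invertible. *)
suff -> : range (Qop l%:q T) = spectral_space E (far l n).
  by case: (closed_spectral_space sE (measurable_far l n)).
have mf := measurable_far l n; have mC := measurable_setC1 l.
apply/seteqP; split=> [_ [x _ <-]|y yf]; last first.
  have [S [[Sf _ _ _] SQ]] := Qop_invertible_on_far bT sT sE l n.
  by exists (S y) => //; case: (SQ _ yf).
rewrite /spectral_space /= (pvm_Qop bT sT sE)//.
have bE := bounded_op_pvm sE mf; have bQ := bounded_op_Qop l%:q bT.
apply/eqP; rewrite eq_sym -subr_eq0 -(bounded_opB bQ); apply/eqP.
suff : op_ker (Qop l%:q T) (x - E (far l n) x) by [].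
rewrite (op_ker_Qop bT sT sE).
have -> : E (far l n) x = E (~` [set l]) x.
  rewrite -[in LHS](setIidl (@far_sub R l n)) (pvm_setI sE)//; apply/esym/eqP.
  by rewrite -subr_eq0 (pvm_far_punct sE) ?p0//; exact: (spectral_space_pvm sE).
by rewrite (pvm_compl sE)// setCK; exact: (spectral_space_pvm sE).
Qed.

Lemma discrete_isolated_finite_kernel : discrete_S_spectrum T l%:q ->
  isolated (S_spectrum T) l%:q /\ finite_qdim (op_ker (opshift T l)).
Proof.
have bA := bounded_op_opshift l bT.
move=> [_ [H1 [H2 [[cH1 cH2] [TH1 TH2] H12 fH1 [s12 s1]]]]].
have s1l : S_spectrum_on H1 T = [set l%:q] by rewrite s1 qsphere_real.
have i2 : invertible_on H2 (Qop l%:q T).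
  apply: contrapT => h; have : (S_spectrum_on H1 T `&` S_spectrum_on H2 T) l%:q.
    by split => //; rewrite s1l.
  by rewrite s12.
have [c c0 cT] := Qop_real_bounded_below bT cH2.1 TH2 i2.
split.
  apply/(isolated_spectrumP bT sT); split=> //; exists c => // a /andP[al ac].
  apply; apply: (@invertible_on_direct_sum _ _ H1 H2) => //.
  - exact: bounded_op_Qop.
  - by apply: Qop_invariant => //; case: cH1.
  - by apply: Qop_invariant => //; case: cH2.
  - apply: contrapT => h; have : S_spectrum_on H1 T a%:q by [].
    by rewrite s1l => -[] ale; rewrite ale subrr normr0 ltxx in al.
  (* On [H2] the lower bound [c] of [T - l] drops by at most [|a - l|] when [l] is moved to [a]. *)
  - apply: (@Qop_invertible_on _ _ _ _ _ ((c - `|a - l|) ^+ 2)) => //.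
      by rewrite exprn_gt0// subr_gt0.
    move=> x Hx /=; rewrite /qim2 /= expr0n /= !addr0 mul0r addr0.
    rewrite -ler_norm_sqrl ?subr_ge0 ?(ltW ac)// mulrBl.
    have -> : opshift T a x = opshift T l x - (a - l) *: x.
      by rewrite /opshift scalerBl opprB addrA subrK.
    apply: le_trans (lerB_normD _ _).
    by rewrite normrN normrZ lerD2r; exact: cT.
apply: finite_qdimS fH1 (closed_ker bA) _ => x xk.
have [H120 Hsum _] := H12; have [x1 [x2 [x1H x2H xE]]] := Hsum x.
(* [(T - l) x2 = - (T - l) x1] lies in both summands, hence is 0, and [T - l] is injective on
   [H2]. *)
suff x20 : x2 = 0 by rewrite xE x20 addr0.
have A1 : H1 (opshift T l x1) by apply: opshift_invariant => //; case: cH1.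
have A2 : H2 (opshift T l x2) by apply: opshift_invariant => //; case: cH2.
have : (H1 `&` H2) (opshift T l x2).
  split => //; move: xk; rewrite /op_ker /= xE (bounded_opD bA) addrC => /eqP.
  rewrite addr_eq0 => /eqP ->; rewrite -scaleN1r; exact: qsubmoduleZ cH1.1 A1.
rewrite H120 /= => Ax2; have := cT _ x2H.
by rewrite Ax2 normr0 pmulr_rle0// normr_le0 => /eqP.
Qed.

(* With S the algebraic inverse of A^2 on the range of E({l}^c), the operators
   E(far l n) S are bounded and converge pointwise to S, so Banach-Steinhaus
   makes S bounded. *)
Lemma closed_range_invertible_on : closed (range (Qop l%:q T)) ->
  invertible_on (spectral_space E (~` [set l])) (Qop l%:q T).
Proof.
move=> clQ; set W := spectral_space E _; set Q := Qop l%:q T.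
have bQ : bounded_op Q by exact: bounded_op_Qop.
have ml : measurable [set l] by exact: measurable_set1.
have mC := measurable_setC1 l; have mf := measurable_far l.
have mp := measurable_punct l.
have cW : closed_qsubmodule W by exact: (closed_spectral_space sE).
have Wm := cW.1; have [W0 WD WZ] := Wm.
have TW : invariant T W by exact: (spectral_space_invariant bT sT sE).
have QW : invariant Q W by exact: Qop_invariant.
have Qinj x y : W x -> W y -> Q x = Q y -> x = y.
  move=> Wx Wy Qxy; apply/eqP; rewrite -subr_eq0; apply/eqP.
  have : op_ker Q (x - y) by rewrite /op_ker /= (bounded_opB bQ) Qxy subrr.
  rewrite (op_ker_Qop bT sT sE) => /(pvm_compl_eq0 sE ml) <-.
  by apply/esym; exact: (qsubmoduleB Wm Wx Wy).
have Qsurj y : exists x, W x /\ Q x = E (~` [set l]) y.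
  set z := E _ y; have Wz : W z by exact: (spectral_space_pvm sE).
  have : range Q z.
    (* Closedness of the range enters here: each [E (far l n) z] is in the range, and these
       approximate [z]. *)
    rewrite [range Q](closure_id _).1// => V /nbhs_ballP[e e0 eV].
    have [n En] := pvm_punct_small sE l z e0.
    have [S [_ SQ]] := Qop_invertible_on_far bT sT sE l n.
    exists (E (far l n) z); split.
      exists (S (E (far l n) z)) => //.
      by case: (SQ _ (spectral_space_pvm sE z (mf n))).
    by apply: eV; rewrite -ball_normE /= (pvm_far_punct sE).
  move=> [x _ Qx]; exists (E (~` [set l]) x).
  split; first exact: (spectral_space_pvm sE).
  by rewrite /Q -(pvm_Qop bT sT sE)// -/Q Qx.
have [S SP] := choice Qsurj.
have WS y : W (S y) by case: (SP y).
have QS y : Q (S y) = E (~` [set l]) y by case: (SP y).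
have bC := bounded_op_pvm sE mC.
have Slin a x y : S (a *: x + y) = a *: S x + S y.
  apply: Qinj; rewrite ?QS ?(bounded_opD bC) ?(bounded_opZ bC)//.
    by apply: WD => //; exact: qsubmoduleZ.
  by rewrite (bounded_opD bQ) (bounded_opZ bQ) !QS.
pose F : set (H -> H) := [set E (far l n) \o S | n in setT].
have FB f : F f -> bounded_fun_norm f /\ linear f.
  move=> [n _ <-]; have bn := bounded_op_pvm sE (mf n); split; last first.
    by move=> a x y /=; rewrite Slin (bounded_opD bn) (bounded_opZ bn).
  (* Applying [Q] to [E (far l n) (S x)] gives projections of [x], so [c^-1] bounds this operator;
     [c] depends on [n], and uniformity comes from Banach-Steinhaus. *)
  have [//|c c0 cQ] := invertible_on_bounded_below
    (Qop_invertible_on_far bT sT sE l n).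
    apply: Qop_invariant => //.
      by case: (closed_spectral_space sE (mf n)).
    exact: (spectral_space_invariant bT sT sE).
  move=> r; exists (c^-1 * r) => x xr /=; rewrite ler_pdivlMl//.
  apply: le_trans (cQ _ (spectral_space_pvm sE _ (mf n))) _.
  rewrite -(pvm_Qop bT sT sE)// -/Q QS (le_trans (norm_pvm sE _ (mf n)))//.
  by rewrite (le_trans (norm_pvm sE _ mC)).
have Fpt : pointwise_bounded F.
  move=> x; exists `|S x| => _ [n _ <-] /=; exact: (norm_pvm sE).
have [M FM] := Banach_Steinhauss FB Fpt 1.
have SM x : `|x| <= 1 -> `|S x| <= M.
  move=> x1; apply/ler_addgt0Pr => e e0.
  have [n En] := pvm_punct_small sE l (S x) e0.
  rewrite -(subrK (E (far l n) (S x)) (S x)) addrC.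
  rewrite (le_trans (ler_normD _ _))// lerD//.
    by apply: (FM (E (far l n) \o S)) => //; exists n.
  by rewrite (pvm_far_punct sE) ?ltW//; exact: WS.
have M0 : 0 <= M by rewrite (le_trans _ (SM 0 _))// normr0.
have SZ a x : S (a *: x) = a *: S x.
  have S0 : S 0 = 0.
    by have := Slin (-1) 0 0; rewrite scaler0 addr0 scaleN1r addNr.
  by have := Slin a x 0; rewrite S0 !addr0.
have SMx x : `|S x| <= M * `|x|.
  have [->|x0] := eqVneq x 0.
    by rewrite -(scale0r (0 : H)) SZ !scale0r normr0 mulr0.
  have px : 0 < `|x| by rewrite normr_gt0.
  rewrite -ler_pdivrMr// mulrC.
  have := SM (`|x|^-1 *: x); rewrite SZ !normrZ ger0_norm ?invr_ge0//.
  by rewrite mulVf ?gt_eqF//; apply.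
(* [M] may be 0, hence the shift by 1. *)
apply: (@invertible_onI _ _ _ _ ((M + 1)^-1)) => //.
- exact: bounded_opW.
- by rewrite invr_gt0 ltr_wpDl.
- move=> x Wx; rewrite ler_pdivrMl ?ltr_wpDl//.
  have -> : `|x| = `|S (Q x)|.
    congr `|_|; apply: Qinj => //; rewrite QS; exact/esym/QW.
  by rewrite (le_trans (SMx _))// ler_wpM2r// lerDl.
- move=> y Wy; exists (S y) => //; rewrite QS; exact: Wy.
Qed.

Lemma Fredholm_discrete : ~ essential_S_spectrum T l%:q ->
  discrete_S_spectrum T l%:q.
Proof.
move=> /contrapT/Fredholm_QopP[clQ fl]; split=> //.
have ml : measurable [set l] by exact: measurable_set1.
have mC := measurable_setC1 l.
have i2 := closed_range_invertible_on clQ.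
have c1 := closed_spectral_space sE ml; have c2 := closed_spectral_space sE mC.
have t1 := spectral_space_invariant bT sT sE ml.
have t2 := spectral_space_invariant bT sT sE mC.
exists (spectral_space E [set l]), (spectral_space E (~` [set l])).
have ds : topological_direct_sum (spectral_space E [set l])
    (spectral_space E (~` [set l])).
  split.
  - apply/seteqP; split=> [x [x1 /(pvm_compl_eq0 sE mC)]|_ ->].
      by rewrite setCK x1.
    by split; rewrite /spectral_space /= (bounded_op0 (bounded_op_pvm sE _)).
  - move=> x; exists (E [set l] x), (E (~` [set l]) x).
    by split; rewrite ?(pvm_add_compl sE)//; exact: (spectral_space_pvm sE).
  - exists 1 => x1 x2 x1l x2l; rewrite mul1r.
    have b1 := bounded_op_pvm sE ml; have b2 := bounded_op_pvm sE mC.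
    have e1 : E [set l] (x1 + x2) = x1.
      rewrite (bounded_opD b1) x1l -[in E _ x2](setCK [set l]).
      by rewrite (pvm_compl_eq0 sE)// addr0.
    have e2 : E (~` [set l]) (x1 + x2) = x2.
      by rewrite (bounded_opD b2) x2l (pvm_compl_eq0 sE)// add0r.
    have := norm_pvm sE (x1 + x2) ml; have := norm_pvm sE (x1 + x2) mC.
    by rewrite e1 e2.
have s1 : S_spectrum_on (spectral_space E [set l]) T = [set l%:q].
  apply/seteqP; split=> q /= sq.
    have qE := S_spectrum_on_real bT sT c1 t1 sq.
    apply: contrapT => ql; apply: sq.
    (* On this space [T] acts as the scalar [l], so the form of [Qop q T] is at least this multiple
       of [|x|^2]. *)
    have d0 : 0 < (l - qre q) ^+ 2.
      rewrite lt0r sqr_ge0 sqrf_eq0 subr_eq0 andbT; apply/eqP => lq.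
      by apply: ql; rewrite qE lq.
    apply: (Qop_invertible_on bT sT c1 t1 d0) => x.
    rewrite -(ker_opshift bT sT sE) /op_ker /= => /eqP; rewrite subr_eq0.
    rewrite /opshift => /eqP ->; rewrite -scalerBl normrZ exprMn.
    rewrite real_normK ?num_real//.
    by rewrite lerDl mulr_ge0 ?sqr_ge0 ?qim2_ge0.
  (* Invertibility on both summands would put [l] outside the spectrum of [T]. *)
  rewrite {}sq => i1; apply: sl; apply: invertible_on_direct_sum ds _ _ i1 i2.
  - exact: bounded_op_Qop.
  - by apply: Qop_invariant => //; case: c1.
  - by apply: Qop_invariant => //; case: c2.
split=> //; split; last by rewrite s1 qsphere_real.
by rewrite -subset0 s1 => q [/= -> ]; apply.
Qed.

End Implications.

(** * Closing the cycle of implications *)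

Theorem proposition5p2 (R : realType) (H : quatHilbertType R)
    (Hsep : separable_space H) (Hdim : ~ finite_qdim [set: H])
    (T : H -> H) (Tbounded : bounded_op T) (Tsa : adjoint T = T)
    (E : set R -> H -> H) (TE : spectral_measure T E)
    (lambda : R) (lambda_spec : S_spectrum T lambda%:q) :
  [<-> ~ essential_S_spectrum T lambda%:q;
       discrete_S_spectrum T lambda%:q;
       isolated (S_spectrum T) lambda%:q /\
         finite_qdim (op_ker (fun x => T x - lambda *: x));
       isolated (S_spectrum T) lambda%:q /\
         finite_qdim (range (E [set lambda]))].
Proof.
have sT := adjoint_qsymmetric Tsa.
have ml : measurable [set lambda] by exact: measurable_set1.
tfae.
- exact: Fredholm_discrete Tbounded sT TE lambda lambda_spec.
- exact: discrete_isolated_finite_kernel Tbounded sT lambda lambda_spec.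
- rewrite -[op_ker _]/(op_ker (opshift T lambda)) (ker_opshift Tbounded sT TE).
  by rewrite (spectral_space_range TE ml).
- exact: isolated_finite_rank_Fredholm Tbounded sT TE lambda.
Qed.
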